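(* Let $(\mathcal{G},\mathcal{H},j,\langle\cdot,\cdot\rangle)$ be a CR kahlerian Lie algebra such that $\mathcal{G}$ is semi-simple and $\mathcal{H}$ has codimension $1$ in $\mathcal{G}$. Then $\mathcal{G}$ is isomorphic, as a real Lie algebra, to $so(3)$ or to $sl(2)=sl(2,\mathbb{R})$.
   Context: A CR kahlerian Lie algebra $(\mathcal{G},\mathcal{H},j,\langle\cdot,\cdot\rangle)$ consists of a finite-dimensional real Lie algebra $\mathcal{G}$, a vector subspace $\mathcal{H}\subset\mathcal{G}$, a linear endomorphism $j:\mathcal{G}\to\mathcal{G}$ with image $\mathcal{H}$, and a (positive definite) scalar product $\langle\cdot,\cdot\rangle$ on $\mathcal{G}$ such that: (1) $j$ preserves $\mathcal{H}$ and $j^2|_{\mathcal{H}}=-\mathrm{Id}$; (2) $[X,Y]-[jX,jY]\in\mathcal{H}$ for all $X,Y\in\mathcal{H}$; (3) $[jX,jY]=[X,Y]+j([X,jY]+[jX,Y])$ for all $X,Y\in\mathcal{H}$; (4) the bilinear form $\omega(x,y)=\langle x,j(y)\rangle$ on $\mathcal{G}$ is antisymmetric and closed, i.e. $\omega([x,y],z)+\omega([z,x],y)+\omega([y,z],x)=0$ for all $x,y,z\in\mathcal{G}$. *)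

(* Defs.v *)
From HB Require Import structures.
From mathcomp Require Import all_boot all_order all_algebra reals ring.

Set Implicit Arguments.
Unset Strict Implicit.
Unset Printing Implicit Defensive.

Import GRing.Theory Num.Theory.
Local Open Scope ring_scope.

HB.mixin Record Vector_isLieAlgebra (R : fieldType) V of Vector R V := {
  lie : V -> V -> V;
  lie_linearl : forall y, linear (lie ^~ y);
  lie_linearr : forall x, linear (lie x);
  liexx : forall x, lie x x = 0;
  lie_jacobi : forall x y z,
    lie x (lie y z) + lie y (lie z x) + lie z (lie x y) = 0
}.

#[short(type="lieAlgType")]
HB.structure Definition LieAlgebra (R : fieldType) :=
  {V of Vector R V & Vector_isLieAlgebra R V}.

HB.instance Definition _ (R : fieldType) (L : lieAlgType R) :=
  bilinear_isBilinear.Build R L L L *:%R *:%R (@lie R L)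
    (@lie_linearl R L, @lie_linearr R L).

Definition lie_isomorphic (R : fieldType) (L M : lieAlgType R) : Prop :=
  exists f : 'Hom(L, M), bijective f /\ {morph f : x y / lie x y}.

Section Semisimple.
Variables (R : fieldType) (L : lieAlgType R).
Implicit Types U V W I : {vspace L}.

(* By bilinearity the brackets of basis vectors span the same subspace as all
   the brackets [u, v] with u in U and v in V: see lieprod_subvP. *)
Definition lieprod U V : {vspace L} :=
  <<[seq lie u v | u <- vbasis U, v <- vbasis V]>>%VS.

Lemma lieprod_subvP U V W :
  reflect {in U & V, forall u v, lie u v \in W} (lieprod U V <= W)%VS.
Proof.
apply: (iffP span_subvP) => [sW u v uU vV|sW _ /allpairsP[[u v] [uU vV ->]]];
  last by apply: sW; apply: vbasis_mem.
rewrite (coord_vbasis uU) (coord_vbasis vV) linear_sumr memv_suml // => i _.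
rewrite linearZr_LR linear_sumlz; apply: memvZ; apply: memv_suml => k _.
by rewrite linearZl_LR memvZ // sW // allpairs_f // mem_nth // size_tuple.
Qed.

Definition lie_ideal I : Prop := forall x y : L, y \in I -> lie x y \in I.

Definition lie_solvable U : Prop :=
  exists n, iter n (fun V => lieprod V V) U = 0%VS.

Definition semisimple : Prop :=
  forall I, lie_ideal I -> lie_solvable I -> I = 0%VS.

End Semisimple.

Arguments semisimple {R} L.

Record lie_subalg (R : fieldType) (L : lieAlgType R) := LieSubalg {
  lie_subalg_vs :> {vspace L};
  lie_subalg_closed :
    {in lie_subalg_vs &, forall x y, lie x y \in lie_subalg_vs}
}.

Section SubLieAlgebra.
Variables (R : fieldType) (L : lieAlgType R) (S : lie_subalg L).

Definition liesub_of : Type := subvs_of S.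
HB.instance Definition _ := Vector.on liesub_of.

Implicit Types x y z : liesub_of.

(* vsproj only serves to inject into the subtype: see val_liesub. *)
Definition liesub x y : liesub_of := vsproj S (lie (vsval x) (vsval y)).

Lemma val_liesub x y : vsval (liesub x y) = lie (vsval x) (vsval y).
Proof. by rewrite vsprojK // lie_subalg_closed // subvsP. Qed.

Fact liesub_linearl y : linear (liesub ^~ y).
Proof.
by move=> a u v; apply: val_inj; rewrite /= !val_liesub /= linearPl.
Qed.

Fact liesub_linearr x : linear (liesub x).
Proof.
by move=> a u v; apply: val_inj; rewrite /= !val_liesub /= linearPr.
Qed.

Fact liesub_xx x : liesub x x = 0.
Proof. by apply: val_inj; rewrite /= val_liesub liexx. Qed.

Fact liesub_jacobi x y z :
  liesub x (liesub y z) + liesub y (liesub z x) + liesub z (liesub x y) = 0.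
Proof.
by apply: val_inj; rewrite /= !val_liesub lie_jacobi.
Qed.

HB.instance Definition _ := Vector_isLieAlgebra.Build R liesub_of
  liesub_linearl liesub_linearr liesub_xx liesub_jacobi.

End SubLieAlgebra.

Section MatrixLieAlgebra.
Variables (R : fieldType) (n : nat).
Implicit Types A B C : 'M[R]_n.

Definition commutator A B : 'M[R]_n := A *m B - B *m A.

Fact commutator_linearl B : linear (commutator ^~ B).
Proof.
move=> a A C; rewrite /commutator mulmxDl mulmxDr -scalemxAl -scalemxAr.
by rewrite scalerBr opprD addrACA.
Qed.

Fact commutator_linearr A : linear (commutator A).
Proof.
move=> a B C; rewrite /commutator mulmxDl mulmxDr -scalemxAl -scalemxAr.
by rewrite scalerBr opprD addrACA.
Qed.

Fact commutatorxx A : commutator A A = 0.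
Proof. exact: subrr. Qed.

Fact commutator_jacobi A B C :
  commutator A (commutator B C) + commutator B (commutator C A)
    + commutator C (commutator A B) = 0.
Proof.
rewrite /commutator !mulmxBl !mulmxBr !mulmxA !opprB.
set a := A *m B *m C; set b := A *m C *m B; set c := B *m C *m A.
set d := C *m B *m A; set e := B *m A *m C; set f := C *m A *m B.
apply/matrixP => i k; rewrite !mxE.
move: (a i k) (b i k) (c i k) (d i k) (e i k) (f i k) => {}a {}b {}c {}d {}e {}f.
ring.
Qed.

HB.instance Definition _ := Vector_isLieAlgebra.Build R 'M[R]_n
  commutator_linearl commutator_linearr commutatorxx commutator_jacobi.

Definition add_trmx A : 'M[R]_n := A + A^T.

Fact add_trmx_linear : linear add_trmx.
Proof. by move=> a A B; rewrite /add_trmx linearP scalerDr addrACA. Qed.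

HB.instance Definition _ := GRing.isLinear.Build R 'M[R]_n 'M[R]_n *:%R
  add_trmx add_trmx_linear.

Definition so_vs : {vspace 'M[R]_n} := lker (linfun add_trmx).

Definition sl_vs : {vspace 'M[R]_n} :=
  lker (linfun (mxtrace : 'M[R]_n -> R^o)).

Lemma mem_so A : (A \in so_vs) = (A^T == - A).
Proof. by rewrite memv_ker lfunE /= /add_trmx addrC addr_eq0. Qed.

Lemma mem_sl A : (A \in sl_vs) = (\tr A == 0).
Proof. by rewrite memv_ker lfunE. Qed.

Fact so_closed : {in so_vs &, forall A B, lie A B \in so_vs}.
Proof.
move=> A B; rewrite !mem_so => /eqP At /eqP Bt.
by rewrite /lie/= /commutator linearB /= !trmx_mul At Bt !mulmxN !mulNmx !opprK opprB.
Qed.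

Fact sl_closed : {in sl_vs &, forall A B, lie A B \in sl_vs}.
Proof.
by move=> A B _ _; rewrite mem_sl linearB /= mxtrace_mulC subrr.
Qed.

End MatrixLieAlgebra.

Definition so (R : fieldType) (n : nat) : lieAlgType R :=
  liesub_of (LieSubalg (@so_closed R n)).

Definition sl (R : fieldType) (n : nat) : lieAlgType R :=
  liesub_of (LieSubalg (@sl_closed R n)).

Record CR_kahlerian (R : realType) (G : lieAlgType R) (H : {vspace G})
    (j : 'End(G)) (dot : {dot G for idfun}) : Prop := CRKahlerian {
  CR_image : limg j = H;
  CR_stable : (j @: H <= H)%VS;
  CR_square : {in H, forall x, j (j x) = - x};
  CR_bracket : {in H &, forall x y, lie x y - lie (j x) (j y) \in H};
  CR_integrable : {in H &, forall x y,
    lie (j x) (j y) = lie x y + j (lie x (j y) + lie (j x) y)};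
  CR_antisym : forall x y, dot x (j y) = - dot y (j x);
  CR_closed : forall x y z,
    dot (lie x y) (j z) + dot (lie z x) (j y) + dot (lie y z) (j x) = 0
}.

(* Main.v *)
From HB Require Import structures.
Require Import Defs.
From mathcomp Require Import all_boot all_order all_algebra reals.
From mathcomp Require Import boolp complex ring lra.
Local Open Scope ring_scope.

Set Implicit Arguments.
Unset Strict Implicit.
Unset Printing Implicit Defensive.
Import Order.TTheory GRing.Theory Num.Theory VectorInternalTheory.

(** Why the theorem holds.  The form w(x, y) = <x, j y> is closed, and its
    kernel is ker j, which is a line because j has corank one.  A semisimple
    algebra has nondegenerate Killing form B ([semisimple_killing_nondeg]), and
    then every closed form is exact: w(x, y) = B([a, x], y) for some a
    ([closed_form_inner]).  Hence the centralizer of a is the line ker j, and it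
    is spanned by a itself.  An algebra with nondegenerate Killing form that
    contains such an element has dimension 3 ([centralizer_line_dim3], applied
    after complexification), and in dimension 3 the nondegenerate Killing form
    leaves only so(3) and sl(2) ([dim3_classification]).

    Nondegeneracy of B is Cartan's criterion.  Let I be the radical of B and let
    x be a sum of brackets [u, v] with u in I.  Over the complex numbers, let D
    act on the generalized eigenspace of ad x for the eigenvalue l as the
    conjugate of l.  Conjugation is additive, so D is a derivation, and moving D
    across the trace gives tr(D ad x) = - sum of B(u, D v) = 0.  On the other
    hand this trace is the sum of the |l|^2, so ad x is nilpotent.  By Engel's
    theorem [I, I] is solvable, thus I is a solvable ideal and vanishes.

    Dimension 3.  Suppose that over the complex numbers the centralizer of a is
    the line of a.  If even the generalized kernel of ad a is that line, scale a
    so that its largest weights have modulus 1, one of them being 1, and pick e, f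
    with [a, e] = e, [a, f] = - f, [e, f] = a.  Nondegeneracy of B shows that the
    weight spaces of 1 and - 1 are the lines of e and f.  A vector x of another
    nonzero weight m cannot have both [e, x] and [f, x] nonzero, since
    |m + 1| <= 1 and |m - 1| <= 1 force m = 0; the relations between e, f and a
    then give m = 1/2 or m = - 1/2, which the Jacobi identity excludes.  So
    a, e, f is a basis.  If the generalized kernel is larger, then [h, a] = a for
    some h, and the previous case applies to h instead of a.

    Classification.  In a Killing-orthogonal basis x, y, z each bracket of two
    basis vectors is orthogonal to both of them, hence proportional to the third.
    Rescaling turns the three coefficients into signs; up to rotation and a global
    sign change they are those of so(3) or those of sl(2). *)

(** * Functional calculus for a complex matrix *)

Section Triangular.
Variables (F : fieldType) (n : nat) (T : 'M[F]_n.+1).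
Hypothesis T_trig : is_trig_mx T.

Lemma horner_mx_trig (p : {poly F}) :
  is_trig_mx (horner_mx T p) /\ forall i, horner_mx T p i i = p.[T i i].
Proof.
have Tlt := is_trig_mxP T_trig.
elim/poly_ind: p => [|p c [/is_trig_mxP pT pE]].
  rewrite rmorph0; split; first by apply/is_trig_mxP => i k _; rewrite mxE.
  by move=> i; rewrite mxE horner0.
rewrite rmorphD rmorphM /= horner_mx_X horner_mx_C.
split=> [|i]; last first.
  rewrite !mxE eqxx mulr1n hornerMXaddC (bigD1 i) //= pE big1 ?addr0 // => k ki.
  have [lt|gt|/val_inj eq] := ltngtP i k; first by rewrite pT ?mul0r.
    by rewrite Tlt ?mulr0.
  by rewrite eq eqxx in ki.
apply/is_trig_mxP => i k ik; rewrite !mxE big1 => [|l _].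
  by rewrite -val_eqE /= (ltn_eqF ik) mulr0n addr0.
have [il|li] := ltnP i l; first by rewrite pT ?mul0r.
by rewrite Tlt ?mulr0 // (leq_ltn_trans li).
Qed.
End Triangular.

Section Spectrum.
Variables (C : numClosedFieldType).

(** After Schur triangularization the traces of all polynomials in A are read
    off the diagonal. *)
Lemma mxtrace_horner n (A : 'M[C]_n.+1) : exists2 r : seq C,
  char_poly A = \prod_(z <- r) ('X - z%:P) &
  forall p, \tr (horner_mx A p) = \sum_(z <- r) p.[z].
Proof.
have [//|P Pu simA] := Schur A; have Punit := unitarymx_unit Pu.
have := simA; rewrite /similar_to conjumx //; set T := _ *m _ => Ttrig.
have PA : P *m A = T *m P by rewrite /T mulmxKV.
have hP p : P *m horner_mx A p = horner_mx T p *m P.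
  elim/poly_ind: p => [|p c IH]; first by rewrite !rmorph0 mulmx0 mul0mx.
  rewrite !rmorphD !rmorphM /= !horner_mx_X !horner_mx_C mulmxDr mulmxDl.
  by rewrite scalar_mxC -!mulmxE mulmxA IH -mulmxA PA mulmxA.
exists [seq T i i | i <- enum 'I_n.+1].
  rewrite big_image /= -char_poly_trig //.
  have: map_mx polyC P *m char_poly_mx A = char_poly_mx T *m map_mx polyC P.
    by rewrite /char_poly_mx mulmxBr mulmxBl -!map_mxM PA scalar_mxC.
  move=> /(congr1 determinant); rewrite !det_mulmx mulrC => /mulIf eqdet.
  by apply: eqdet; rewrite det_map_mx polyC_eq0 -unitfE -unitmxE.
move=> p; rewrite big_image /=.
have -> : horner_mx A p = invmx P *m (horner_mx T p *m P) by rewrite -hP mulKmx.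
rewrite mxtrace_mulC -mulmxA mulmxV // mulmx1.
by apply: eq_bigr => i _; have [_ ->] := horner_mx_trig Ttrig p.
Qed.

Lemma prod_XsubC_count (r : seq C) z :
  \prod_(w <- r) ('X - w%:P) =
  ('X - z%:P) ^+ count_mem z r * \prod_(w <- r | w != z) ('X - w%:P).
Proof.
elim: r => [|w r IH] /=; first by rewrite !big_nil mulr1.
rewrite !big_cons IH; case: (eqVneq w z) => [->|_] /=; first by rewrite exprS mulrA.
by rewrite mulrCA.
Qed.

Lemma coprimep_XsubC_cofactor (r : seq C) z k :
  coprimep (('X - z%:P) ^+ k) (\prod_(w <- r | w != z) ('X - w%:P)).
Proof.
apply: coprimep_expl; rewrite coprimep_sym coprimep_XsubC -big_filter.
by rewrite root_prod_XsubC mem_filter eqxx.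
Qed.

(** Hermite interpolation with constant jets: the polynomial p equals f z at
    z to the order of z as a root.  Newton's scheme adds the roots one at a
    time. *)
Lemma interpolation (f : C -> C) (r : seq C) : exists p : {poly C},
  forall z, ('X - z%:P) ^+ count_mem z r %| p - (f z)%:P.
Proof.
elim: r => [|w r [p pP]]; first by exists 0 => z; rewrite dvd1p.
set g := \prod_(u <- r | u != w) ('X - u%:P).
have gw : g.[w] != 0.
  have := coprimep_XsubC_cofactor r w 1; rewrite expr1 coprimep_sym.
  by rewrite coprimep_XsubC.
have /dvdpP[q qE] := pP w.
(* For p - f w = ('X - w)^m q and with the product of the earlier factors equal
   to ('X - w)^m g, adding c times that product kills the next coefficient at w
   exactly when q(w) + c g(w) = 0. *)
exists (p + (- q.[w] / g.[w])%:P * \prod_(u <- r) ('X - u%:P)) => z /=.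
rewrite addrAC; have [<-|zw] /= := eqVneq w z; last first.
  by rewrite dvdp_add // dvdp_mull // (prod_XsubC_count r z) dvdp_mulIl.
rewrite (prod_XsubC_count r w) qE mulrCA [q * _]mulrC -mulrDr exprSr.
rewrite dvdp_mul // dvdp_XsubCl /root !hornerE mulfVK //.
by rewrite addrN.
Qed.

Lemma horner_mx_vanish n (A : 'M[C]_n.+1) (v : 'rV_n.+1) p q :
  coprimep p q -> v *m horner_mx A p = 0 -> v *m horner_mx A q = 0 -> v = 0.
Proof.
move=> /Bezout_eq1_coprimepP[[u w] /= uw] vp vq.
have -> : v = v *m horner_mx A 1 by rewrite rmorph1 mulmx1.
rewrite -uw mulrC [w * q]mulrC.
by rewrite rmorphD !rmorphM /= mulmxDr -!mulmxE !mulmxA vp vq !mul0mx addr0.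
Qed.

(** Primary decomposition: a Bezout relation between the factor at one root
    and the product of the others splits v in two. *)
Lemma gen_eigen_decomp_row n (A : 'M[C]_n.+1) (r : seq C) (v : 'rV_n.+1) :
    v *m horner_mx A (\prod_(z <- r) ('X - z%:P)) = 0 ->
  exists2 s : seq (C * 'rV_n.+1), v = \sum_(c <- s) c.2 &
    forall c, c \in s -> exists k, c.2 *m horner_mx A (('X - c.1%:P) ^+ k) = 0.
Proof.
elim: {r}_.+1 {-2}r (ltnSn (size r)) v => // m IH [|z r] /= rm v.
  by rewrite big_nil rmorph1 mulmx1 => ->; exists [::]; rewrite ?big_nil.
set r1 := z :: r => v0.
set p := ('X - z%:P) ^+ count_mem z r1.
set g := \prod_(w <- r1 | w != z) ('X - w%:P).
have kill q : v *m horner_mx A (p * g * q) = 0.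
  by rewrite -prod_XsubC_count rmorphM -mulmxE mulmxA v0 mul0mx.
have /Bezout_eq1_coprimepP[[u w] /= uw] : coprimep p g.
  exact: coprimep_XsubC_cofactor.
case: (IH [seq w <- r1 | w != z] _ (v *m horner_mx A (u * p))).
- by rewrite /= eqxx /= size_filter (leq_ltn_trans (count_size _ _)) // -ltnS.
- by rewrite big_filter -/g -mulmxA mulmxE -rmorphM /= -mulrA mulrC kill.
move=> s sE sP; exists ((z, v *m horner_mx A (w * g)) :: s).
  rewrite big_cons -sE /= -mulmxDr -rmorphD addrC uw rmorph1.
  by rewrite mulmx1.
move=> c; rewrite inE => /orP[/eqP-> /=|/sP//].
exists (count_mem z r1).
by rewrite -/p -mulmxA mulmxE -rmorphM /= mulrC mulrCA mulrC kill.
Qed.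

(** The interpolation polynomial of f, evaluated at A, is multiplication by
    f z on the generalized eigenspace of z. *)
Lemma spectral_calculus_row n (A : 'M[C]_n.+1) (f : C -> C) :
  exists2 p : {poly C}, forall k z (v : 'rV_n.+1),
   v *m horner_mx A (('X - z%:P) ^+ k) = 0 -> v *m horner_mx A p = f z *: v &
   forall z, root (char_poly A) z -> p.[z] = f z.
Proof.
have [r rE _] := mxtrace_horner A; have [p pP] := interpolation f r.
exists p => [k z v vk|z]; last first.
  rewrite rE root_prod_XsubC -has_pred1 has_count => zr.
  have: 'X - z%:P %| p - (f z)%:P by rewrite (dvdp_trans _ (pP z)) // dvdp_exp // .
  by rewrite dvdp_XsubCl /root !hornerE subr_eq0 => /eqP.
have /dvdpP[q qE] := pP z.
suff v0 : v *m horner_mx A (('X - z%:P) ^+ count_mem z r) = 0.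
  have -> : p = q * ('X - z%:P) ^+ count_mem z r + (f z)%:P by rewrite -qE subrK.
  rewrite rmorphD mulrC rmorphM /= mulmxDr -mulmxE mulmxA v0 mul0mx add0r.
  by rewrite horner_mx_C mul_mx_scalar.
apply: (@horner_mx_vanish _ A _ (('X - z%:P) ^+ k)
  (\prod_(w <- r | w != z) ('X - w%:P))).
- exact: coprimep_XsubC_cofactor.
- by rewrite -mulmxA mulmxE comm_horner_mx2 -mulmxE mulmxA vk mul0mx.
- rewrite -mulmxA mulmxE -rmorphM /= -prod_XsubC_count -rE.
  by rewrite Cayley_Hamilton mulmx0.
Qed.
End Spectrum.

(** * Traces and generalized eigenvectors of endomorphisms *)

Section LfunTrace.
Variables (F : fieldType) (V : vectType F).
Implicit Types (T S : 'End(V)) (x : V).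

Lemma v2r_lfun T x : v2r (T x) = v2r x *m f2mx T.
Proof. by rewrite unlock /= r2vK. Qed.

Lemma f2mx_comp T S : f2mx (T \o S)%VF = f2mx S *m f2mx T.
Proof.
apply/row_matrixP => i; rewrite !rowE mulmxA -[delta_mx 0 i]r2vK -!v2r_lfun.
by rewrite comp_lfunE.
Qed.

Definition lftrace T : F := \tr (f2mx T).

Fact lftrace_is_linear : linear_for *%R lftrace.
Proof.
move=> c T S; rewrite /lftrace (_ : f2mx _ = c *: f2mx T + f2mx S) ?linearP //.
apply/row_matrixP => i; rewrite !rowE mulmxDr -scalemxAr.
rewrite -[delta_mx 0 i]r2vK -!v2r_lfun.
by rewrite add_lfunE scale_lfunE linearP.
Qed.
HB.instance Definition _ :=
  GRing.isLinear.Build F 'End(V) F *%R lftrace lftrace_is_linear.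

Lemma lftraceC T S : lftrace (T \o S)%VF = lftrace (S \o T)%VF.
Proof. by rewrite /lftrace !f2mx_comp mxtrace_mulC. Qed.

Definition gen_eigen T z x := exists k, iter k (fun y => T y - z *: y) x = 0.

End LfunTrace.

Section Spectral.
Variables (C : numClosedFieldType) (V : vectType C).
Implicit Types (T S : 'End(V)) (x : V).


Lemma gen_eigen_row n (A : 'M[C]_n.+1) z k (v : 'rV_n.+1) :
  iter k (fun w => w *m A - z *: w) v = v *m horner_mx A (('X - z%:P) ^+ k).
Proof.
rewrite rmorphXn rmorphB /= horner_mx_X horner_mx_C.
elim: k => [|k /= ->]; first by rewrite mulmx1.
by rewrite exprSr -mulmxE mulmxA [RHS]mulmxBr mul_mx_scalar.
Qed.

Lemma v2r_gen_eigen T z k x :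
  v2r (iter k (fun y => T y - z *: y) x) =
  iter k (fun w => w *m f2mx T - z *: w) (v2r x).
Proof. by elim: k => //= k <-; rewrite linearB linearZ /= v2r_lfun. Qed.

Lemma gen_eigenP T z x :
  gen_eigen T z x <-> exists k, iter k (fun w => w *m f2mx T - z *: w) (v2r x) = 0.
Proof.
split=> -[k kx]; exists k; first by rewrite -v2r_gen_eigen kx linear0.
by apply: v2r_inj; rewrite v2r_gen_eigen kx linear0.
Qed.

Lemma gen_eigen_decomp T x : exists2 s : seq (C * V), x = \sum_(c <- s) c.2 &
  forall c, c \in s -> gen_eigen T c.1 c.2.
Proof.
suff [s sE sP] : exists2 s : seq (C * 'rV_(dim V)), v2r x = \sum_(c <- s) c.2 &
    forall c, c \in s -> exists k, iter k (fun w => w *m f2mx T - c.1 *: w) c.2 = 0.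
  exists [seq (c.1, r2v c.2) | c <- s].
    by rewrite big_map -(linear_sum r2v) /= -sE v2rK.
  by move=> _ /mapP[c cs ->]; apply/gen_eigenP; rewrite r2vK; apply: sP.
case: (dim V) (f2mx T) (v2r x) => [|n] A v.
  by exists [::]; rewrite ?big_nil // [v]thinmx0.
have [r rE _] := mxtrace_horner A.
have [|s -> sP] := @gen_eigen_decomp_row _ _ A r v.
  by rewrite -rE Cayley_Hamilton mulmx0.
by exists s => // c /sP[k kP]; exists k; rewrite gen_eigen_row.
Qed.

(** The sequence r lists the eigenvalues of T with multiplicity, which is why
    it controls both the trace and nilpotency.  With f the conjugation the trace
    is the sum of the squared moduli of the eigenvalues. *)
Lemma spectral_calculus T (f : C -> C) : exists (D : 'End(V)) (r : seq C),
  [/\ forall z x, gen_eigen T z x -> D x = f z *: x,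
      lftrace (D \o T)%VF = \sum_(z <- r) z * f z &
      (forall z, z \in r -> z = 0) -> exists k, forall x, iter k T x = 0].
Proof.
suff [A [r [AP Atr Anil]]] : exists (A : 'M[C]_(dim V)) (r : seq C),
  [/\ forall z (v : 'rV_(dim V)) k,
        iter k (fun w => w *m f2mx T - z *: w) v = 0 -> v *m A = f z *: v,
      \tr (f2mx T *m A) = \sum_(z <- r) z * f z &
      (forall z, z \in r -> z = 0) ->
        exists k, forall v : 'rV_(dim V), iter k (mulmxr (f2mx T)) v = 0].
  exists (Hom A), r; split=> [z x|| /Anil[k kP]].
  - move=> /gen_eigenP[k /AP xA].
    by apply: v2r_inj; rewrite v2r_lfun xA linearZ.
  - by rewrite /lftrace f2mx_comp.
  exists k => x; apply: v2r_inj; rewrite linear0 -[RHS](kP (v2r x)).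
  by elim: (k) => //= m <-; rewrite v2r_lfun.
case: (dim V) (f2mx T) => [|n] A.
  exists 0, [::]; split=> [z v k _||_]; rewrite ?[v]thinmx0 ?mul0mx ?scaler0 //.
    by rewrite big_nil [A]thinmx0 mul0mx linear0.
  by exists 0%N => v; rewrite thinmx0.
have [p pP proot] := spectral_calculus_row A f; have [r rE rtr] := mxtrace_horner A.
exists (horner_mx A p), r; split=> [z v k||r0].
- by rewrite gen_eigen_row; apply: pP.
- rewrite -{1}[A](horner_mx_X A) mulmxE -rmorphM rtr; apply: eq_big_seq => z zr.
  by rewrite !hornerE proot // rE root_prod_XsubC.
exists (size r) => v; have := gen_eigen_row A 0 (size r) v.
rewrite (_ : ('X - 0%:P) ^+ size r = char_poly A); last first.
  rewrite rE (eq_big_seq _ (fun z zr => congr1 _ (r0 z zr))) big_const_seq.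
  by rewrite count_predT iter_mulr_1.
rewrite Cayley_Hamilton mulmx0 => v0; rewrite -[RHS]v0.
by apply: eq_iter => w; rewrite scale0r subr0.
Qed.

Lemma spectrum T : exists r : seq C,
  (forall z x, gen_eigen T z x -> x != 0 -> z \in r) /\
  (forall z, z \in r -> exists2 x, x != 0 & T x = z *: x).
Proof.
suff [r [rP rE]] : exists r : seq C,
  (forall z (v : 'rV_(dim V)) k,
     iter k (fun w => w *m f2mx T - z *: w) v = 0 -> v != 0 -> z \in r) /\
  (forall z, z \in r -> exists2 v : 'rV_(dim V), v != 0 & v *m f2mx T = z *: v).
  exists r; split=> [z x /gen_eigenP[k /rP zr] x0|z /rE[v v0 vz]].
    by apply: zr; apply: contraNneq x0 => x0; apply/eqP/v2r_inj; rewrite x0 linear0.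
  exists (r2v v); first by apply: contraNneq v0 => v0; rewrite -[v]r2vK v0 linear0.
  by apply: v2r_inj; rewrite v2r_lfun linearZ /= r2vK.
case: (dim V) (f2mx T) => [|n] A.
  by exists [::]; split=> // z v k _; rewrite [v]thinmx0 eqxx.
have [r rE _] := mxtrace_horner A; exists r; split=> z; last first.
  by rewrite -root_prod_XsubC -rE -eigenvalue_root_char => /eigenvalueP[v]; exists v.
move=> v k; rewrite gen_eigen_row => vk; apply: contraNT => zr.
apply/eqP/(horner_mx_vanish _ vk (q := char_poly A)); last first.
  by rewrite Cayley_Hamilton mulmx0.
by apply: coprimep_expl; rewrite coprimep_sym coprimep_XsubC rE root_prod_XsubC.
Qed.
End Spectral.

(** * Derivations and the Killing form *)

(** The Leibniz rule makes h^(k + l) b(x, y) a sum of terms b(f^i x, g^j y)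
    with i + j = k + l, in each of which i >= k or j >= l.  Applied to shifted
    derivations it says that weights add under the bracket, and that the Killing
    form pairs only opposite weights. *)
Lemma iter_leibniz (U V W : zmodType) (b : U -> V -> W)
    (f : U -> U) (g : V -> V) (h : W -> W) :
    (forall y, b 0 y = 0) -> (forall x, b x 0 = 0) -> {morph h : u v / u + v} ->
    (forall x y, h (b x y) = b (f x) y + b x (g y)) ->
  forall k l x y, iter k f x = 0 -> iter l g y = 0 -> iter (k + l) h (b x y) = 0.
Proof.
move=> b0l b0r hD hb.
have h0 : h 0 = 0 by apply: (addrI (h 0)); rewrite -hD !addr0.
have it0 n : iter n h 0 = 0 by elim: n => //= n ->.
have itD n : {morph iter n h : u v / u + v}.
  by elim: n => //= n IH u v /=; rewrite IH hD.
suff H n : forall k l x y, (k + l = n)%N -> iter k f x = 0 -> iter l g y = 0 ->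
    iter n h (b x y) = 0 by move=> k l x y; apply: H.
elim: n => [|n IH] k l x y kl.
  by move/eqP: kl; rewrite addn_eq0 => /andP[/eqP-> _] /= ->; rewrite b0l.
case: k kl => [_ x0 _|k kl]; first by rewrite (x0 : x = 0) b0l it0.
case: l kl => [_ _ y0|l kl kx ly]; first by rewrite (y0 : y = 0) b0r it0.
have [e1 e2] : ((k + l.+1 = n) /\ (k.+1 + l = n))%N.
  by rewrite addSnnS; move: kl; rewrite addSn => -[->].
have kx' := kx; have ly' := ly; rewrite iterSr in kx'; rewrite iterSr in ly'.
by rewrite iterSr hb itD (IH _ _ _ _ e1 kx' ly) (IH _ _ _ _ e2 kx ly') addr0.
Qed.

Section LieBasics.
Variables (F : fieldType) (L : lieAlgType F).
Implicit Types (x y z : L) (D : 'End(L)).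

Lemma lieN x y : lie y x = - lie x y.
Proof.
apply/eqP; rewrite -addr_eq0; apply/eqP.
by have := liexx (y + x); rewrite linearDl /= !linearDr /= !liexx add0r addr0.
Qed.

Lemma lie_leibniz x y z : lie x (lie y z) = lie (lie x y) z + lie y (lie x z).
Proof.
rewrite [lie (lie x y) z]lieN [lie x z]lieN linearNr -opprD.
by apply/eqP; rewrite -addr_eq0 [lie z _ + _]addrC addrA lie_jacobi.
Qed.

HB.instance Definition _ x :=
  GRing.isLinear.Build F L L *:%R (lie x) (lie_linearr x).

Definition ad x : 'End(L) := linfun (lie x).

Lemma adE x y : ad x y = lie x y. Proof. by rewrite /ad lfunE. Qed.

Fact ad_is_linear : linear ad.
Proof.
move=> c x y; apply/lfunP => z.
by rewrite add_lfunE scale_lfunE !adE linearPl.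
Qed.
HB.instance Definition _ := GRing.isLinear.Build F L 'End(L) *:%R ad ad_is_linear.

Definition derivation D := forall x y, D (lie x y) = lie (D x) y + lie x (D y).

Lemma ad_derivation x : derivation (ad x).
Proof. by move=> y z; rewrite !adE lie_leibniz. Qed.

Lemma ad_lie x y : ad (lie x y) = ((ad x \o ad y) - (ad y \o ad x))%VF.
Proof.
apply/lfunP => z; rewrite add_lfunE opp_lfunE !comp_lfunE !adE.
by rewrite (lie_leibniz x) addrK.
Qed.

Lemma derivation_comm D x : derivation D -> ((D \o ad x) - (ad x \o D))%VF = ad (D x).
Proof.
move=> dD; apply/lfunP => z; rewrite add_lfunE opp_lfunE !comp_lfunE !adE.
by rewrite dD addrK.
Qed.

Lemma gen_eigen_lie D (z w : F) x y : derivation D ->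
  gen_eigen D z x -> gen_eigen D w y -> gen_eigen D (z + w) (lie x y).
Proof.
move=> dD [k kx] [l ly]; exists (k + l)%N.
apply: (iter_leibniz _ _ _ _ kx ly) => [v|v|u v|u v].
- by rewrite linear0l.
- by rewrite linear0r.
- by rewrite linearD scalerDr opprD addrACA.
- by rewrite dD scalerDl opprD linearBl linearBr linearZl_LR linearZr_LR /= addrACA.
Qed.

Definition killing x y : F := lftrace (ad x \o ad y)%VF.

Lemma killingC x y : killing x y = killing y x.
Proof. exact: lftraceC. Qed.

Fact killing_linearr x : linear_for *%R (killing x).
Proof. by move=> c y z; rewrite /killing linearP comp_lfunDr -comp_lfunZr linearP. Qed.
Fact killing_linearl y : linear_for *%R (killing ^~ y).
Proof. by move=> c x z; rewrite !(killingC _ y) killing_linearr. Qed.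
HB.instance Definition _ := bilinear_isBilinear.Build F L L F *%R *%R killing
  (killing_linearl, killing_linearr).

(** Expand ad [x, y] as a commutator and move ad y cyclically: what remains is
    the trace of ad x composed with [ad y, D] = - ad (D y).  With D = ad z this is
    the invariance of the Killing form; with the derivation of conjugate
    eigenvalues it drives Cartan's criterion. *)
Lemma lftrace_ad_derivation D x y : derivation D ->
  lftrace (ad (lie x y) \o D)%VF = - killing x (D y).
Proof.
move=> dD; rewrite /killing -derivation_comm // ad_lie comp_lfunDl comp_lfunNl linearB /=.
rewrite comp_lfunDr comp_lfunNr linearB /= opprB !comp_lfunA; congr (_ - _).
by rewrite [LHS]lftraceC comp_lfunA [LHS]lftraceC comp_lfunA.
Qed.

Lemma killing_lie x y z : killing (lie x y) z = killing x (lie y z).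
Proof.
rewrite {1}/killing lftrace_ad_derivation; last exact: ad_derivation.
by rewrite adE lieN linearNr opprK.
Qed.

Lemma killing_gen_eigen a (z w : F) x y :
  gen_eigen (ad a) z x -> gen_eigen (ad a) w y -> killing x y != 0 -> z + w = 0.
Proof.
move=> [k kx] [l ly] xy; apply/eqP; apply: contraNT xy => zw.
suff : iter (k + l) (fun c => - (z + w) * c) (killing x y) = 0.
  elim: (k + l)%N => [/= -> //|n IH /= /eqP].
  by rewrite mulf_eq0 oppr_eq0 (negPf zw) => /eqP.
apply: (iter_leibniz _ _ _ _ kx ly) => [v|v|u v|u v].
- by rewrite linear0l.
- by rewrite linear0r.
- by rewrite mulrDr.
- rewrite linearBl linearBr linearZl_LR linearZr_LR /= !adE mulNr mulrDl opprD.
  rewrite addrACA -[LHS]add0r; congr (_ + _).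
  by rewrite lieN linearNl /= killing_lie addNr.
Qed.

Definition killing_nondeg := forall x, (forall y, killing x y = 0) -> x = 0.


(** The basis of the coordinate isomorphism [v2r]. *)
Definition coord_vec i : L := r2v (delta_mx 0 i).

Lemma coord_vec_sum x : x = \sum_i v2r x 0 i *: coord_vec i.
Proof.
rewrite -[LHS]v2rK [v2r x in LHS]row_sum_delta linear_sum.
by apply: eq_bigr => i _; rewrite linearZ.
Qed.

Lemma scalar_coord_vec (f g : L -> F) : scalar f -> scalar g ->
  (forall i, f (coord_vec i) = g (coord_vec i)) -> f =1 g.
Proof.
move=> fl gl fg y.
pose f' : {scalar L} := HB.pack f (GRing.isLinear.Build _ _ _ _ _ fl).
pose g' : {scalar L} := HB.pack g (GRing.isLinear.Build _ _ _ _ _ gl).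
rewrite -[f y]/(f' y) -[g y]/(g' y) [y]coord_vec_sum !linear_sum.
by apply: eq_bigr => i _; rewrite !linearZ /= fg.
Qed.

Definition killing_row x : 'rV[F]_(dim L) := \row_i killing x (coord_vec i).

Fact killing_row_linear : linear killing_row.
Proof. by move=> c x y; apply/rowP => i; rewrite !mxE linearPl. Qed.
HB.instance Definition _ := GRing.isLinear.Build F L 'rV_(dim L) *:%R
  killing_row killing_row_linear.

Definition killing_radical : {vspace L} := lker (linfun killing_row).

Lemma killing_radicalP x :
  reflect (forall y, killing x y = 0) (x \in killing_radical).
Proof.
rewrite memv_ker lfunE; apply: (iffP eqP) => [/rowP x0|x0]; last first.
  by apply/rowP => i; rewrite !mxE x0.
apply: (@scalar_coord_vec _ (fun _ => 0)) => [|c u v|i].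
- exact: killing_linearr.
- by rewrite mulr0 addr0.
- by have := x0 i; rewrite !mxE.
Qed.

Lemma killing_nondeg_exists x : killing_nondeg -> x != 0 ->
  exists y, killing x y != 0.
Proof.
move=> nondeg x0.
suff /existsP[i xi] : [exists i, killing x (coord_vec i) != 0] by exists (coord_vec i).
apply: contraNT x0; rewrite negb_exists => /forallP xi.
apply/eqP/nondeg/killing_radicalP; rewrite memv_ker lfunE; apply/eqP/rowP => i.
by have := xi i; rewrite negbK !mxE => /eqP.
Qed.

(** The parameter space U lets the same statement represent one functional
    (U the ground field) and a whole bilinear form (U = L). *)
Lemma killing_represents (U : vectType F) (w : U -> L -> F) :
    (forall u, scalar (w u)) -> (forall y, scalar (w ^~ y)) -> killing_nondeg ->
  exists D : 'Hom(U, L), forall u y, w u y = killing (D u) y.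
Proof.
move=> wr wl nondeg.
pose f u : 'rV[F]_(dim L) := \row_i w u (coord_vec i).
have fl : linear f by move=> c u v; apply/rowP => i; rewrite !mxE wl.
pose wF := linfun (HB.pack_for {linear U -> 'rV_(dim L)} f
  (GRing.isLinear.Build _ _ _ _ _ fl)).
pose kF := linfun killing_row.
have kF0 : lker kF = 0%VS.
  apply/eqP; rewrite -subv0; apply/subvP => x /killing_radicalP/nondeg ->.
  exact: mem0v.
have kFf : limg kF = fullv.
  apply/eqP; rewrite eqEdim subvf /= limg_dim_eq ?kF0 ?capv0 //.
  by rewrite !dimvf /dim /= mul1n.
exists (kF^-1 \o wF)%VF => u; apply: scalar_coord_vec => // [|i].
  exact: killing_linearr.
have /rowP/(_ i) : killing_row ((kF^-1 \o wF)%VF u) = f u.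
  rewrite comp_lfunE -[LHS](lfunE killing_row) limg_lfunVK ?lfunE //.
  by rewrite kFf memvf.
by rewrite !mxE => ->.
Qed.

(** Write w(x, y) = B(D x, y).  Closedness of w says that D is a derivation.
    Let a represent the functional y |-> tr(D ad y); then E = D - ad a is a
    derivation with tr(E ad z) = 0 for all z, so B(x, E y) = - tr(E ad [x, y])
    vanishes and D = ad a. *)
Lemma closed_form_inner (w : L -> L -> F) :
    (forall x, scalar (w x)) -> (forall y, scalar (w ^~ y)) -> killing_nondeg ->
    (forall x y, w y x = - w x y) ->
    (forall x y z, w (lie x y) z + w (lie z x) y + w (lie y z) x = 0) ->
  exists a, forall x y, w x y = killing (lie a x) y.
Proof.
move=> wr wl nondeg wN wc.
have [D wD] := killing_represents wr wl nondeg.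
have dD : derivation D.
  move=> x y; apply/eqP; rewrite -subr_eq0; apply/eqP/nondeg => z.
  have e1 : killing (lie (D x) y) z = - w (lie y z) x by rewrite killing_lie -wD wN.
  have e2 : killing (lie x (D y)) z = - w (lie z x) y.
    rewrite lieN linearNl /= killing_lie -wD [lie x z]lieN -wN.
    pose g : {scalar L} := HB.pack (w y) (GRing.isLinear.Build _ _ _ _ _ (wr y)).
    by rewrite -[w y]/(g : L -> F) linearN opprK.
  rewrite linearBl linearDl /= -wD e1 e2 opprD !opprK addrA addrAC.
  exact: wc.
have [||A AD] :=
  @killing_represents F^o (fun c y => c * lftrace (D \o ad y)%VF) _ _ nondeg.
- by move=> u c y z; rewrite linearP comp_lfunDr -comp_lfunZr linearP mulrDr mulrCA.
- by move=> y c u v; rewrite mulrDl mulrA.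
pose E := D - ad (A 1).
have dE : derivation E.
  move=> x y; rewrite !add_lfunE !opp_lfunE dD ad_derivation linearBl linearBr /=.
  by rewrite opprD addrACA.
exists (A 1) => x y; rewrite wD -adE; congr (killing _ y).
apply/eqP; rewrite -subr_eq0 -opp_lfunE -add_lfunE -/E; apply/eqP/nondeg => z.
rewrite killingC; apply: oppr_inj; rewrite -lftrace_ad_derivation // lftraceC.
rewrite comp_lfunDl comp_lfunNl linearB /= -[lftrace (D \o _)%VF]mul1r AD.
by rewrite subrr oppr0.
Qed.
End LieBasics.

(** * Complexification *)

Section Complexification.
Variables (R : rcfType) (L : lieAlgType R).
Local Notation C := R[i].
Local Notation toC := (real_complex R).

Definition complexification : Type := 'rV[C]_(dim L).
HB.instance Definition _ := Vector.on complexification.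

Definition cplx_emb (x : L) : complexification := map_mx toC (v2r x).

Lemma cplx_embP c x y : cplx_emb (c *: x + y) = toC c *: cplx_emb x + cplx_emb y.
Proof. by rewrite /cplx_emb linearP map_mxD map_mxZ. Qed.

Lemma cplx_emb_is_additive : additive cplx_emb.
Proof. by move=> x y; rewrite /cplx_emb linearB map_mxB. Qed.
HB.instance Definition _ :=
  GRing.isAdditive.Build L complexification cplx_emb cplx_emb_is_additive.

Lemma cplx_embZ c x : cplx_emb (c *: x) = toC c *: cplx_emb x.
Proof. by rewrite -[c *: x]addr0 cplx_embP raddf0 addr0. Qed.

Lemma cplx_emb_inj : injective cplx_emb.
Proof. by move=> x y /map_mx_inj /(can_inj v2rK). Qed.

Definition real_part (u : complexification) : L := r2v (map_mx (@complex.Re R) u).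
Definition imag_part (u : complexification) : L := r2v (map_mx (@complex.Im R) u).

Lemma cplx_decomp u : u = cplx_emb (real_part u) + ('i)%C *: cplx_emb (imag_part u).
Proof.
apply/rowP => i; rewrite !mxE !r2vK !mxE; exact: complexE.
Qed.

Lemma cplx_eq0 x y : cplx_emb x + ('i)%C *: cplx_emb y = 0 -> x = 0 /\ y = 0.
Proof.
move=> /rowP xy0; split; apply: (can_inj v2rK); rewrite linear0; apply/rowP => i;
  by have := xy0 i; rewrite !mxE /= => -[]; simpc => // -[].
Qed.

Lemma cplx_ext (V : lmodType C) (f g : complexification -> V) : linear f -> linear g ->
  (forall x, f (cplx_emb x) = g (cplx_emb x)) -> f =1 g.
Proof.
move=> fl gl fg u; rewrite [u]cplx_decomp addrC fl gl.
by rewrite !fg.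
Qed.

(** The bilinear extension of the bracket from the real coordinate basis. *)
Definition cplx_lie (u v : complexification) : complexification :=
  \sum_i \sum_k (u 0 i * v 0 k) *: cplx_emb (lie (coord_vec i : L) (coord_vec k)).

Fact cplx_lie_linearl v : linear (cplx_lie ^~ v).
Proof.
move=> c u w; rewrite /cplx_lie scaler_sumr -big_split /=; apply: eq_bigr => i _.
rewrite scaler_sumr -big_split /=; apply: eq_bigr => k _.
by rewrite !mxE scalerA mulrDl scalerDl mulrA.
Qed.

Fact cplx_lie_linearr u : linear (cplx_lie u).
Proof.
move=> c v w; rewrite /cplx_lie scaler_sumr -big_split /=; apply: eq_bigr => i _.
rewrite scaler_sumr -big_split /=; apply: eq_bigr => k _.
by rewrite !mxE scalerA mulrDr scalerDl mulrCA.
Qed.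

Lemma cplx_lie_cplx_emb x y : cplx_lie (cplx_emb x) (cplx_emb y) = cplx_emb (lie x y).
Proof.
rewrite [x in RHS]coord_vec_sum [y in RHS]coord_vec_sum linear_sumlz raddf_sum.
apply: eq_bigr => i _; rewrite linearZl_LR linear_sumr /= scaler_sumr raddf_sum.
by apply: eq_bigr => k _; rewrite linearZr_LR /= scalerA cplx_embZ !mxE rmorphM.
Qed.

Let lieZl c u v : cplx_lie (c *: u) v = c *: cplx_lie u v.
Proof.
pose g : {linear complexification -> complexification} := HB.pack (cplx_lie ^~ v)
  (GRing.isLinear.Build _ _ _ _ _ (cplx_lie_linearl v)).
exact: (linearZ_LR g).
Qed.
Let lieZr c u v : cplx_lie v (c *: u) = c *: cplx_lie v u.
Proof.
pose g : {linear complexification -> complexification} := HB.pack (cplx_lie v)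
  (GRing.isLinear.Build _ _ _ _ _ (cplx_lie_linearr v)).
exact: (linearZ_LR g).
Qed.

Fact cplx_liexx u : cplx_lie u u = 0.
Proof.
rewrite [u]cplx_decomp addrC !(cplx_lie_linearl, cplx_lie_linearr, lieZl, lieZr).
rewrite !cplx_lie_cplx_emb !liexx raddf0 scaler0 add0r addr0 lieN raddfN.
by rewrite scalerN addrC subrr.
Qed.

Fact cplx_lie_jacobi u v w :
  cplx_lie u (cplx_lie v w) + cplx_lie v (cplx_lie w u)
    + cplx_lie w (cplx_lie u v) = 0.
Proof.
pose J u v w := cplx_lie u (cplx_lie v w) + cplx_lie v (cplx_lie w u)
    + cplx_lie w (cplx_lie u v).
have Jl v1 v2 : linear (fun u1 => J u1 v1 v2).
  move=> c u1 u2; rewrite /J !(cplx_lie_linearl, cplx_lie_linearr) !scalerDr.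
  by rewrite [X in X + _ = _]addrACA [LHS]addrACA.
(* The cyclic symmetry of J brings each argument in turn to the first place,
   where linearity reduces it to real vectors. *)
have JC u1 v1 w1 : J u1 v1 w1 = J v1 w1 u1 by rewrite /J -addrA addrC.
have zl : linear (fun _ : complexification => 0 : complexification).
  by move=> c ? ?; rewrite scaler0 addr0.
rewrite -/(J u v w) (cplx_ext (Jl v w) zl) // => x.
rewrite JC (cplx_ext (Jl w _) zl) // => y.
rewrite JC (cplx_ext (Jl _ _) zl) // => z.
by rewrite /J !cplx_lie_cplx_emb -!raddfD lie_jacobi raddf0.
Qed.

HB.instance Definition _ := Vector_isLieAlgebra.Build C complexification
  cplx_lie_linearl cplx_lie_linearr cplx_liexx cplx_lie_jacobi.

Lemma lie_cplx_emb x y : lie (cplx_emb x) (cplx_emb y) = cplx_emb (lie x y).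
Proof. exact: cplx_lie_cplx_emb. Qed.

Lemma dim_cplx : \dim {: complexification} = \dim {: L}.
Proof. by rewrite !dimvf /dim /= mul1n. Qed.

(** The coordinate isomorphism of a space of row vectors is not the identity,
    so the trace has to be conjugated back. *)
Lemma lftrace_row n (f : 'End('rV[C]_n)) (A : 'M[C]_n) :
  (forall v, f v = v *m A) -> lftrace f = \tr A.
Proof.
move=> fA.
pose P : 'M[C]_(n, dim 'rV[C]_n) := lin1_mx v2r.
pose Q : 'M[C]_(dim 'rV[C]_n, n) := lin1_mx r2v.
have PQ : P *m Q = 1%:M.
  apply/row_matrixP => i; rewrite !rowE mulmxA /P /Q !mul_rV_lin1 /= v2rK.
  by rewrite mulmx1.
rewrite /lftrace (_ : f2mx f = Q *m A *m P).
  by rewrite mxtrace_mulC mulmxA PQ mul1mx.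
apply/row_matrixP => i; rewrite !rowE !mulmxA /P /Q !mul_rV_lin1 /=.
by rewrite -fA v2r_lfun r2vK.
Qed.

Lemma lftrace_cplx (T : 'End(L)) (T' : 'End(complexification)) :
  (forall x, T' (cplx_emb x) = cplx_emb (T x)) -> lftrace T' = toC (lftrace T).
Proof.
move=> TT'; rewrite (@lftrace_row _ T' (map_mx toC (f2mx T))); last first.
  move=> v; have := @cplx_ext complexification T' (mulmxr (map_mx toC (f2mx T))).
  move=> ->//; [exact: linearP | exact: linearP |].
  by move=> x; rewrite TT' /= /cplx_emb -map_mxM v2r_lfun.
by rewrite trace_map_mx.
Qed.

Lemma killing_cplx_emb x y : killing (cplx_emb x) (cplx_emb y) = toC (killing x y).
Proof.
apply: lftrace_cplx => z; rewrite !comp_lfunE !adE.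
by rewrite !lie_cplx_emb.
Qed.

Lemma iter_lie_cplx_emb x k y :
  iter k (lie (cplx_emb x)) (cplx_emb y) = cplx_emb (iter k (lie x) y).
Proof. by elim: k => //= k ->; rewrite lie_cplx_emb. Qed.

Lemma killing_nondeg_cplx : killing_nondeg L -> killing_nondeg complexification.
Proof.
move=> nondeg u u0; rewrite [u]cplx_decomp.
have [re im] : (forall y, killing (real_part u) y = 0) /\
    (forall y, killing (imag_part u) y = 0).
  suff H y : killing (real_part u) y = 0 /\ killing (imag_part u) y = 0.
    by split=> y; have [] := H y.
  have := u0 (cplx_emb y).
  rewrite {1}[u]cplx_decomp linearDl linearZl_LR /= !killing_cplx_emb.
  by simpc => -[].
by rewrite (nondeg _ re) (nondeg _ im) raddf0 scaler0 addr0.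
Qed.

Lemma centralizer_cplx a : (forall x, lie a x = 0 -> x \in <[a]>%VS) ->
  forall u, lie (cplx_emb a) u = 0 -> u \in <[cplx_emb a]>%VS.
Proof.
move=> Ca u; rewrite [u]cplx_decomp linearD linearZ /= !lie_cplx_emb => /cplx_eq0[].
move=> /Ca/vlineP[c ->] /Ca/vlineP[d ->]; rewrite !cplx_embZ.
by rewrite memvD ?memvZ ?memv_line.
Qed.
End Complexification.

(** * Cartan's criterion *)

Section Cartan.
Variables (R : rcfType) (L : lieAlgType R).
Local Notation C := R[i].

(** D is the operator that multiplies the generalized eigenspace of ad x for z
    by the conjugate of z.  The trace of D ad x is the sum of the |z|^2, and it is
    also - sum of B(p.1, D p.2), which vanishes because p.1 is in the radical. *)
Lemma radical_bracket_nilpotent (s : seq (L * L)) :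
    (forall p, p \in s -> forall y, killing p.1 y = 0) ->
  exists k, forall z, iter k (lie (\sum_(p <- s) lie p.1 p.2)) z = 0.
Proof.
move=> sP; set x := \sum_(p <- s) _.
have [D [r [DP Dtr Dnil]]] := spectral_calculus (ad (cplx_emb x)) (@Num.conj C).
have dD : derivation D.
  move=> u v; have [su -> suP] := gen_eigen_decomp (ad (cplx_emb x)) u.
  rewrite !linear_sumlz /= !(linear_sum D) linear_sumlz -big_split /=.
  apply: eq_big_seq => cu /suP cuP.
  have [sv -> svP] := gen_eigen_decomp (ad (cplx_emb x)) v.
  rewrite !linear_sumr /= !(linear_sum D) linear_sumr -big_split /=.
  apply: eq_big_seq => cv /svP cvP.
  rewrite (DP _ _ cuP) (DP _ _ cvP) (DP _ _ (gen_eigen_lie (ad_derivation _) cuP cvP)).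
  by rewrite rmorphD scalerDl linearZl_LR linearZr_LR.
have rad0 p u : p \in s -> killing (cplx_emb p.1) u = 0.
  move=> /sP p0; rewrite [u]cplx_decomp linearDr linearZr_LR /= !killing_cplx_emb.
  by rewrite !p0 rmorph0 mulr0 addr0.
have tr0 : lftrace (D \o ad (cplx_emb x))%VF = 0.
  rewrite lftraceC /x raddf_sum (linear_sum (@ad _ _)).
  rewrite (big_morph (fun T => T \o D)%VF (fun _ _ => comp_lfunDl _ _ _)
    (comp_lfun0l _ _)).
  rewrite linear_sum big_seq big1 // => p ps.
  by rewrite /= -lie_cplx_emb lftrace_ad_derivation //= rad0 ?oppr0.
have [|k kP] := Dnil.
  move=> z zr; have := Dtr; rewrite tr0 => /esym/eqP.
  rewrite psumr_eq0 => [/allP/(_ z zr)|w _]; last by rewrite -normCK exprn_ge0.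
  by rewrite -normCK expf_eq0 normr_eq0 => /eqP.
exists k => z; apply: cplx_emb_inj.
rewrite -iter_lie_cplx_emb raddf0 -[RHS](kP (cplx_emb z)).
by apply: eq_iter => u; rewrite adE.
Qed.
End Cartan.

Section Engel.
Variables (F : fieldType) (L : lieAlgType F).
Implicit Types (U V W K : {vspace L}) (x y z : L).

Lemma mem_lieprod U V u v : u \in U -> v \in V -> lie u v \in lieprod U V.
Proof. exact: (lieprod_subvP U V _ (subvv _)). Qed.

Lemma lieprodS U U' V V' :
  (U <= U')%VS -> (V <= V')%VS -> (lieprod U V <= lieprod U' V')%VS.
Proof.
move=> sU sV; apply/lieprod_subvP => u v uU vV.
by rewrite mem_lieprod // (subvP sU, subvP sV).
Qed.

Lemma lieprod_sum U V x : x \in lieprod U V -> exists2 s : seq (L * L),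
  x = \sum_(p <- s) lie p.1 p.2 & forall p, p \in s -> p.1 \in U /\ p.2 \in V.
Proof.
move=> xUV; pose b := in_tuple [seq lie u v | u <- vbasis U, v <- vbasis V].
rewrite (coord_span (X := b) xUV).
elim: (index_enum _) => [|i r [s sE sP]].
  by exists [::]; rewrite ?big_nil.
have /allpairsP[[u v] [/= uU vV uv]] : b`_i \in b by exact/mem_nth/ltn_ord.
exists ((coord b i x *: u, v) :: s).
  by rewrite !big_cons sE uv /= linearZl_LR.
move=> p; rewrite inE => /orP[/eqP-> /=|/sP//].
by rewrite memvZ // vbasis_mem // (vbasis_mem vV).
Qed.

Lemma iter_lieprodS n K K' V V' : (K <= K')%VS -> (V <= V')%VS ->
  (iter n (lieprod K) V <= iter n (lieprod K') V')%VS.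
Proof. by move=> sK sV; elim: n => //= n IH; apply: lieprodS. Qed.

Definition subalgebra U := (lieprod U U <= U)%VS.
Definition ad_nilpotent x := exists k, forall z, iter k (lie x) z = 0.
(** All products of m operators ad k with k in K vanish, for some m. *)
Definition acts_nilpotently K := exists m, iter m (lieprod K) fullv = 0%VS.

(** Apply K repeatedly to U until the result first falls inside K: a vector
    found just before that step and outside K normalizes K. *)
Lemma engel_normalizer K U : subalgebra U -> (K <= U)%VS -> acts_nilpotently K ->
  ~~ (U <= K)%VS ->
  exists x, [/\ x \in U, x \notin K & forall k, k \in K -> lie k x \in K].
Proof.
move=> Usub KU [m m0] UK; pose W i := iter i (lieprod K) U.
have exW : exists i, (W i <= K)%VS.
  exists m; apply: subv_trans (sub0v _).
  by rewrite -m0 iter_lieprodS ?subvf.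
have WU i : (W i <= U)%VS.
  by elim: i => //= i IH; apply: subv_trans Usub; apply: lieprodS.
case: (ex_minnP exW) => -[|j] Wj jmin; first by rewrite Wj in UK.
have /subvPn[x xW xK] : ~~ (W j <= K)%VS.
  by apply/negP => /jmin; rewrite ltnn.
exists x; split=> //; first exact: subvP (WU j) _ xW.
by move=> k kK; apply: (subvP Wj); apply: mem_lieprod.
Qed.

(** The flag V i obtained by applying K i times to the whole algebra is stable
    under x, because x normalizes K.  Between V i and V i.+1 only powers of ad x
    matter, so p applications of K + <[x]> descend one step of the flag when
    (ad x)^p = 0. *)
Lemma engel_extend K x : subalgebra K -> acts_nilpotently K ->
  (forall k, k \in K -> lie k x \in K) -> ad_nilpotent x ->
  subalgebra (K + <[x]>) /\ acts_nilpotently (K + <[x]>).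
Proof.
move=> Ksub [m m0] Kx [p px]; set K' := (K + <[x]>)%VS.
have xK k : k \in K -> lie x k \in K by move=> /Kx; rewrite lieN memvN.
split.
  apply: subv_trans (addvSl _ _).
  apply/lieprod_subvP => _ _ /memv_addP[k kK [_ /vlineP[c ->] ->]]
    /memv_addP[l lK [_ /vlineP[d ->] ->]].
  rewrite linearDl !linearDr /= !linearZl_LR /= !linearZr_LR /= liexx !scaler0 addr0 /=.
  by rewrite !memvD ?memvZ ?Kx ?xK // (subvP Ksub) // mem_lieprod.
pose V i := iter i (lieprod K) fullv.
have Vdec i : (V i.+1 <= V i)%VS.
  by elim: i => [|i IH]; rewrite ?subvf //= lieprodS.
have xV i v : v \in V i -> lie x v \in V i.
  elim: i v => [|i IH] v; first by rewrite !memvf.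
  suff /subvP/(_ v) : (V i.+1 <= ad x @^-1: V i.+1)%VS.
    by move=> H /H; rewrite -memv_preim adE.
  apply/lieprod_subvP => k w kK wV.
  rewrite -memv_preim adE lie_leibniz memvD //; apply: mem_lieprod => //.
    exact: xK.
  exact: IH.
pose X i j := iter j (lfun_img (ad x)) (V i).
have XV i j : (X i j <= V i)%VS.
  elim: j => //= j IH; apply/subvP => _ /memv_imgP[v /(subvP IH) vV ->].
  by rewrite adE xV.
have K'V i j : (iter j (lieprod K') (V i) <= X i j + V i.+1)%VS.
  elim: j => [|j IH]; first exact: addvSl.
  apply: subv_trans (lieprodS (subvv _) IH) _.
  apply/lieprod_subvP => _ _ /memv_addP[k kK [_ /vlineP[c ->] ->]]
    /memv_addP[a aX [b bV ->]].
  have xa : lie x a \in X i j.+1 by rewrite -adE memv_img.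
  rewrite linearDl linearZl_LR /= (linearD (lie x)) scalerDr addrC -addrA.
  apply: memv_add; first exact: memvZ.
  apply: memvD; first by apply: memvZ; apply: (xV i.+1).
  apply: mem_lieprod => //.
  by rewrite memvD ?(subvP (XV _ _) _ aX) ?(subvP (Vdec _) _ bV).
have Xp i : X i p = 0%VS.
  apply/eqP; rewrite -subv0; apply/subvP => v vX.
  suff [w ->] : exists w, v = iter p (lie x) w by rewrite px mem0v.
  rewrite /X in vX; elim: (p) v vX => [|j IH] v; first by exists v.
  by move=> /memv_imgP[u /IH[w ->] ->]; exists w; rewrite adE.
exists (m * p)%N; apply/eqP; rewrite -subv0 -m0 -/(V m).
elim: (m) => [|i IH]; first exact: subvf.
rewrite mulSn iterD; apply: subv_trans (iter_lieprodS _ (subvv _) IH) _.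
by apply: subv_trans (K'V i p) _; rewrite Xp add0v.
Qed.

(** Enlarge a nilpotently acting subalgebra of U one dimension at a time. *)
Theorem engel U : subalgebra U -> {in U, forall x, ad_nilpotent x} ->
  acts_nilpotently U.
Proof.
move=> Usub Unil.
suff H n K : (\dim U - \dim K < n)%N -> (K <= U)%VS -> subalgebra K ->
    acts_nilpotently K -> acts_nilpotently U.
  apply: (H _ 0%VS (ltnSn _)); rewrite ?sub0v //.
    by apply/lieprod_subvP => u v; rewrite !memv0 => /eqP-> _; rewrite linear0l.
  exists 1%N; apply/eqP; rewrite -subv0; apply/lieprod_subvP => u v.
  by rewrite !memv0 => /eqP-> _; rewrite linear0l.
elim: n K => // n IH K Kn KU Ksub Knil.
have [UK|UK] := boolP (U <= K)%VS.
  by rewrite (_ : U = K) //; apply/eqP; rewrite eqEsubv UK.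
have [x [xU xK Kx]] := engel_normalizer Usub KU Knil UK.
have [K'sub K'nil] := engel_extend Ksub Knil Kx (Unil _ xU).
have K'U : (K + <[x]> <= U)%VS by rewrite subv_add KU -memvE.
apply: (IH _ _ K'U K'sub K'nil); rewrite ltnS in Kn; apply: leq_trans Kn.
apply: ltn_sub2l.
  apply: contraR UK; rewrite -leqNgt => UK.
  by have := eqEdim K U; rewrite KU UK => /eqP ->.
rewrite ltnNge; apply: contra xK => dK'.
have := eqEdim K (K + <[x]>); rewrite addvSl dK' => /eqP ->.
by rewrite (subvP (addvSr _ _)) ?memv_line.
Qed.

Lemma acts_nilpotently_solvable U : subalgebra U -> acts_nilpotently U -> lie_solvable U.
Proof.
move=> Usub [m m0]; exists m; apply/eqP; rewrite -subv0 -m0.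
suff H i : (iter i (fun V => lieprod V V) U <= U)%VS /\
    (iter i (fun V => lieprod V V) U <= iter i (lieprod U) fullv)%VS by have [] := H m.
elim: i => [|i [IH1 IH2]]; first by rewrite subvv subvf.
by split; [apply: subv_trans Usub; apply: lieprodS|apply: lieprodS].
Qed.
End Engel.

Section CartanCriterion.
Variables (R : rcfType) (L : lieAlgType R).

(** With I the radical of the Killing form, the derived algebra of I consists of
    ad-nilpotent elements, so Engel's theorem makes it solvable. *)
Theorem semisimple_killing_nondeg : semisimple L -> killing_nondeg L.
Proof.
set I := killing_radical L; move=> ssL x x0.
suff I0 : I = 0%VS by apply/eqP; rewrite -memv0 -I0; apply/killing_radicalP.
have idI : lie_ideal I.
  move=> u v /killing_radicalP v0; apply/killing_radicalP => w.
  by rewrite lieN linearNl /= killing_lie v0 oppr0.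
apply: ssL => //.
have subI : subalgebra I by apply/lieprod_subvP => u v _; apply: idI.
have subJ : subalgebra (lieprod I I) by apply: lieprodS.
have [|m mP] := acts_nilpotently_solvable subJ (engel subJ _).
  move=> u /lieprod_sum[s -> sP]; apply: radical_bracket_nilpotent => p /sP[pI _].
  exact/killing_radicalP.
by exists m.+1; rewrite iterSr.
Qed.
End CartanCriterion.

(** * Algebras with an element whose centralizer is a line *)

Section GenEigen.
Variables (F : fieldType) (V : vectType F) (T : 'End(V)).

Lemma eigen_gen_eigen (z : F) x : T x = z *: x -> gen_eigen T z x.
Proof. by move=> Tx; exists 1%N; rewrite /= Tx subrr. Qed.

Lemma iter_eigen (z w : F) k x : T x = w *: x ->
  iter k (fun y => T y - z *: y) x = (w - z) ^+ k *: x.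
Proof.
move=> Tx; elim: k => [|k /= ->]; first by rewrite expr0 scale1r.
by rewrite linearZ /= Tx !scalerA -scalerBl exprS; congr (_ *: _); ring.
Qed.

Lemma gen_eigen_ker z x : T x = 0 -> gen_eigen T z x -> z != 0 -> x = 0.
Proof.
move=> Tx [k kx] z0; apply/eqP; move/eqP: kx.
rewrite (@iter_eigen z 0) ?scale0r // scaler_eq0 expf_eq0 sub0r oppr_eq0 (negPf z0).
by rewrite andbF.
Qed.

Lemma gen_eigen_linear z c x y :
  gen_eigen T z x -> gen_eigen T z y -> gen_eigen T z (c *: x + y).
Proof.
pose S : 'End(V) := T - z *: \1%VF.
have SE k u : iter k (fun y => T y - z *: y) u = iter k S u.
  by apply: eq_iter => v; rewrite add_lfunE opp_lfunE scale_lfunE id_lfunE.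
have SD k : linear (iter k S).
  by elim: k => // k IH d u v /=; rewrite IH linearP.
have S0 k : iter k S 0 = 0 by elim: k => //= k ->; rewrite linear0.
move=> [k kx] [l ly]; exists (k + l)%N; rewrite SE SD.
by rewrite [in X in _ *: X]addnC !iterD -!SE kx ly SE S0 scaler0 add0r SE S0.
Qed.
End GenEigen.

Section Norms.
Variable C : numClosedFieldType.
(** By the parallelogram identity 2 |z|^2 + 2 = |z + 1|^2 + |z - 1|^2 <= 2. *)
Lemma norm_shift_eq0 (z : C) : `|z + 1| <= 1 -> `|z - 1| <= 1 -> z = 0.
Proof.
move=> zp zm; apply/eqP; rewrite -normr_eq0 -sqrf_eq0.
rewrite eq_le exprn_ge0 // andbT.
have h1 : `|z + 1| ^+ 2 <= 1 by rewrite expr_le1.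
have h2 : `|z - 1| ^+ 2 <= 1 by rewrite expr_le1.
have : (`|z + 1| ^+ 2 + `|z - 1| ^+ 2) <= 1 + 1 by apply: lerD.
rewrite !normCK !rmorphD !rmorphN rmorph1 /=.
set w := z^* .
rewrite (_ : _ + _ = 2 * (z * w) + (1 + 1)); last by ring.
by rewrite -lerBrDr subrr pmulr_rle0 // ltr0n.
Qed.
End Norms.

Section Sl2.
Variables (F : fieldType) (L : lieAlgType F) (a e f : L).
Hypothesis (ae : lie a e = e) (af : lie a f = - f) (ef : lie e f = a).

(** With y = [f, x] one has [a, x] = [e, y], and [f, y] = 0 gives
    2 [a, y] = - y; applying e yields 2 [a, [a, x]] = [a, x].  So a vector with
    [e, x] = 0 and [f, [f, x]] = 0 only has the weights 0 and 1/2. *)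
Lemma sl2_half x : lie e x = 0 -> lie f (lie f x) = 0 ->
  lie a (lie a x) *+ 2 = lie a x.
Proof.
move=> ex ffx; set y := lie f x in ffx *.
have ax : lie a x = lie e y.
  by rewrite -ef /y lie_leibniz ex raddf0 addr0.
have ay : lie a y *+ 2 = - y.
  have : lie a y = - lie f (lie a x).
    by rewrite ax [in RHS]lie_leibniz ffx raddf0 addr0 [lie f e]lieN ef linearNl opprK.
  rewrite (lie_leibniz f a x) [lie f a]lieN af opprK -/y => ay.
  by rewrite mulr2n {1}ay opprD addrNK.
have eay : lie e (lie a y) *+ 2 = - lie e y by rewrite -raddfMn ay raddfN.
by rewrite ax (lie_leibniz a e y) ae mulrnDl eay mulr2n addrK.
Qed.
End Sl2.

Section RankOne.
Variables (C : numClosedFieldType) (L : lieAlgType C) (a e : L).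
Hypothesis nondeg : killing_nondeg L.
Hypothesis a0 : a != 0.
Hypothesis Ca : forall x, gen_eigen (ad a) 0 x -> x \in <[a]>%VS.
Hypothesis bound : forall z x, gen_eigen (ad a) z x -> x != 0 -> `|z| <= 1.
Local Notation G := (gen_eigen (ad a)).

Lemma weight_lie z w x y : G z x -> G w y -> G (z + w) (lie x y).
Proof. exact/gen_eigen_lie/ad_derivation. Qed.

Lemma weight_eigen z x : lie a x = z *: x -> G z x.
Proof. by move=> ax; apply: eigen_gen_eigen; rewrite adE. Qed.

Lemma weight0_self : G 0 a.
Proof. by apply: weight_eigen; rewrite liexx scale0r. Qed.

Lemma killing_weight_pairing z x : G z x -> x != 0 ->
  exists2 y, G (- z) y & killing x y != 0.
Proof.
move=> xz x0.
have [y xy] := killing_nondeg_exists nondeg x0.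
have [s sE sP] := gen_eigen_decomp (ad a) y.
move: xy; rewrite sE linear_sumr => xs.
have [c cs xc] : exists2 c, c \in s & killing x c.2 != 0.
  apply/hasP; apply: contraNT xs => /hasPn xs; rewrite big_seq big1 // => c /xs.
  by rewrite negbK => /eqP.
exists c.2 => //.
have := killing_gen_eigen xz (sP _ cs) xc => /eqP; rewrite addrC addr_eq0 => /eqP <-.
exact: sP.
Qed.

Lemma killing_aa : killing a a != 0.
Proof.
have [y] := killing_weight_pairing weight0_self a0; rewrite oppr0 => /Ca/vlineP[c ->].
by rewrite linearZr_LR mulf_eq0 => /norP[].
Qed.

(** The bracket has weight 0, hence is a multiple of a, and pairing with a
    determines the multiple. *)
Lemma lie_opposite_weights z x y : lie a x = z *: x -> G (- z) y ->
  lie x y = (z * killing x y / killing a a) *: a.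
Proof.
move=> ax yz; have /Ca/vlineP[c xy] : G 0 (lie x y).
  by rewrite -(subrr z); apply: weight_lie yz; apply: weight_eigen.
rewrite xy; congr (_ *: _); apply: (mulIf killing_aa); rewrite divfK ?killing_aa //.
have : killing a (lie x y) = z * killing x y by rewrite -killing_lie ax linearZl_LR.
by rewrite xy linearZr_LR.
Qed.

Lemma weight_norm_gt1 z x : G z x -> 1 < `|z| -> x = 0.
Proof.
move=> /bound xz z1; apply/eqP; apply: contraTT z1 => /xz z1.
by rewrite -real_leNgt ?real1 // normr_real.
Qed.

(** Let f have weight - z with B(u, f) != 0.  If B(u, x) = 0 then [u, x] = 0,
    while [f, x] has the excessive weight - 2z and vanishes; so [[u, f], x] = 0,
    where [u, f] is a nonzero multiple of a, and x would have weight 0. *)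
Lemma unit_weight_killing_inj z u : `|z| = 1 -> lie a u = z *: u -> u != 0 ->
  forall x, G (- z) x -> killing u x = 0 -> x = 0.
Proof.
move=> z1 au u0 x xG ux.
have [f fG uf] := killing_weight_pairing (weight_eigen au) u0.
have z0 : z != 0 by rewrite -normr_eq0 z1 oner_eq0.
have fx : lie f x = 0.
  apply: (weight_norm_gt1 (weight_lie fG xG)).
  rewrite -opprD normrN -mulr2n -mulr_natl normrM z1.
  by rewrite mulr1 normr_nat ltr1n.
have : lie u (lie f x) = 0 by rewrite fx raddf0.
rewrite lie_leibniz (lie_opposite_weights au xG) (lie_opposite_weights au fG).
rewrite ux mulr0 mul0r scale0r raddf0 addr0.
move/eqP; rewrite linearZl_LR scaler_eq0 !mulf_eq0 invr_eq0.
rewrite (negPf z0) (negPf uf) (negPf killing_aa) /= => /eqP ax.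
by apply: (gen_eigen_ker _ xG); rewrite ?adE // oppr_eq0.
Qed.

Hypotheses (e0 : e != 0) (ae : lie a e = e).

Lemma sl2_triple_exists : exists2 f, lie a f = - f & lie e f = a.
Proof.
have ae1 : lie a e = 1 *: e by rewrite scale1r.
have [f0 fG ef] := killing_weight_pairing (weight_eigen ae1) e0.
have Gaf : G (- 1) (lie a f0).
  by rewrite -[-1]add0r; apply: weight_lie fG; apply: weight0_self.
have af : lie a f0 = - f0.
  apply/eqP; rewrite -addr_eq0 -[lie a f0]scale1r; apply/eqP.
  apply: (unit_weight_killing_inj (normr1 _) ae1 e0); first exact: gen_eigen_linear.
  by rewrite scale1r linearDr /= -killing_lie [lie e a]lieN ae linearNl addNr.
pose c := killing e f0 / killing a a.
have c0 : c != 0 by rewrite mulf_neq0 ?invr_eq0 ?killing_aa.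
exists (c^-1 *: f0); first by rewrite linearZ /= af scalerN.
by rewrite linearZ /= (lie_opposite_weights ae1 fG) mul1r scalerA mulVf ?scale1r.
Qed.

Variable f : L.
Hypotheses (af : lie a f = - f) (ef : lie e f = a).

Let f0 : f != 0.
Proof. by apply: contraNneq a0 => f0; rewrite -ef f0 raddf0. Qed.

Let kef : killing e f != 0.
Proof.
have ae1 : lie a e = 1 *: e by rewrite scale1r.
have fG : G (- 1) f by apply: weight_eigen; rewrite scaleN1r.
have := lie_opposite_weights ae1 fG; rewrite ef => aE; apply: contraNneq a0 => kef.
by rewrite aE kef mulr0 mul0r scale0r.
Qed.

Lemma weight1_line x : G 1 x -> x \in <[e]>%VS.
Proof.
move=> xG; apply/vlineP; exists (killing f x / killing f e).
apply/eqP; rewrite -subr_eq0 -scaleNr addrC; apply/eqP.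
have af1 : lie a f = (-1) *: f by rewrite scaleN1r.
apply: (unit_weight_killing_inj _ af1 f0); first by rewrite normrN normr1.
  by rewrite opprK; apply: gen_eigen_linear => //; apply: weight_eigen; rewrite scale1r.
by rewrite linearDr linearZr_LR /= mulNr divfK ?addNr // killingC.
Qed.

Lemma weightN1_line x : G (- 1) x -> x \in <[f]>%VS.
Proof.
move=> xG; apply/vlineP; exists (killing e x / killing e f).
apply/eqP; rewrite -subr_eq0 -scaleNr addrC; apply/eqP.
have ae1 : lie a e = 1 *: e by rewrite scale1r.
apply: (unit_weight_killing_inj (normr1 _) ae1 e0).
  by apply: gen_eigen_linear => //; apply: weight_eigen; rewrite scaleN1r.
by rewrite linearDr linearZr_LR /= mulNr divfK ?addNr.
Qed.

Let Ge z x : G z x -> G (z + 1) (lie e x).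
Proof.
by move=> xG; rewrite addrC; apply: weight_lie xG; apply: weight_eigen; rewrite scale1r.
Qed.
Let Gf z x : G z x -> G (z - 1) (lie f x).
Proof.
by move=> xG; rewrite addrC; apply: weight_lie xG; apply: weight_eigen; rewrite scaleN1r.
Qed.

Lemma highest_weight_half z x :
  G z x -> z != 0 -> lie e x = 0 -> lie f (lie f x) = 0 ->
  lie a x *+ 2 = x.
Proof.
move=> xG z0 ex ffx; apply/eqP; rewrite -subr_eq0; apply/eqP.
apply: (@gen_eigen_ker _ _ (ad a) z) => //.
  by rewrite adE raddfB raddfMn /= (sl2_half ae af ef ex ffx) subrr.
rewrite -scaler_nat -[- x]scaleN1r -[_ *: x]addr0.
apply: gen_eigen_linear.
  by rewrite -[z]add0r; apply: weight_lie xG; exact: weight0_self.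
by apply: gen_eigen_linear => //; exists 0%N.
Qed.

Lemma lowest_weight_half z x :
  G z x -> z != 0 -> lie f x = 0 -> lie e (lie e x) = 0 ->
  lie a x *+ 2 = - x.
Proof.
move=> xG z0 fx eex; apply/eqP; rewrite -subr_eq0 opprK; apply/eqP.
apply: (@gen_eigen_ker _ _ (ad a) z) => //.
  (* - a, f, e satisfy the same relations as a, e, f. *)
  have := @sl2_half _ L (- a) f e _ _ _ x fx eex.
  rewrite !linearNl /= af ae opprK raddfN opprK [lie f e]lieN ef => H.
  by rewrite adE raddfD raddfMn /= H ?addNr.
rewrite -scaler_nat; apply: gen_eigen_linear => //.
by rewrite -[z]add0r; apply: weight_lie xG; exact: weight0_self.
Qed.

(** Let z = [f, y], of weight - 1/2, and w of weight 1/2 with [z, w] = c a and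
    c != 0; write [y, w] = s e.  Every u of weight 1/2 satisfies [u, [f, u]] = 0:
    it is a multiple d a of a, and [e, d a] = - d e while the Jacobi identity
    gives [e, [u, [f, u]]] = (1/2) [u, u] = 0.  Polarizing, [y, [f, w]] = c a.
    The Jacobi identity for z, y, w gives s = c, and for f, y, w it gives
    - s = 2 c, so c = 0. *)
Lemma no_half_weight y : y != 0 -> lie a y *+ 2 = y -> False.
Proof.
move=> y0; pose h : C := 2^-1; have h0 : h != 0 by rewrite invr_eq0 pnatr_eq0.
have hh : h + h = 1 by rewrite -mulr2n -mulr_natl mulfV ?pnatr_eq0.
have halfE x : lie a x *+ 2 = x -> lie a x = h *: x.
  by move=> {2}<-; rewrite -scaler_nat scalerA mulVf ?scale1r ?pnatr_eq0.
move=> /halfE ay.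
have h1 : `|h + 1| > 1.
  by rewrite ger0_norm ?addr_ge0 ?invr_ge0 ?ler0n // ltrDr invr_gt0 ltr0n.
have hN : - h = h - 1 by rewrite -hh opprD addrA subrr add0r.
have h2 : `|h - 1 - 1| > 1 by rewrite -hN -opprD normrN.
have Gh w : G h w -> lie a w = h *: w /\ lie e w = 0.
  move=> wG; have ew : lie e w = 0 by apply: (weight_norm_gt1 (Ge wG)).
  split=> //; apply/halfE/(highest_weight_half wG) => //.
  exact: (weight_norm_gt1 (Gf (Gf wG))).
have yG : G h y by apply: weight_eigen.
have ey := (Gh y yG).2.
pose z := lie f y.
have ez : lie e z = h *: y by rewrite lie_leibniz ef ey raddf0 addr0.
have zG : G (- h) z by rewrite hN; apply: Gf.
have z0 : z != 0.
  by apply: contra_eq_neq ez => ->; rewrite raddf0 eq_sym scaler_eq0 (negPf h0).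
have [w] := killing_weight_pairing zG z0; rewrite opprK => wG zw.
have az : lie a z = - h *: z.
  by rewrite lie_leibniz af linearNl ay linearZ /= hN scalerBl scale1r addrC.
have := lie_opposite_weights az; rewrite opprK => /(_ _ wG).
set c := _ / _ => zwE.
have c0 : c != 0.
  by rewrite mulf_neq0 ?invr_eq0 ?killing_aa // mulf_neq0 // oppr_eq0.
have selfP u : G h u -> lie u (lie f u) = 0.
  move=> uG; have [au eu] := Gh u uG.
  have /Ca/vlineP[d dE] : G 0 (lie u (lie f u)).
    by rewrite -(subrr h) hN; apply: weight_lie => //; apply: Gf.
  have : lie e (lie u (lie f u)) = 0.
    rewrite lie_leibniz eu linear0l add0r (lie_leibniz e f) ef eu raddf0 addr0.
    by rewrite au linearZ /= liexx scaler0.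
  rewrite dE linearZ /= lieN ae scalerN => /eqP.
  rewrite oppr_eq0 scaler_eq0 (negPf e0) orbF.
  by move=> /eqP ->; rewrite scale0r.
have /vlineP[s yw] : lie y w \in <[e]>%VS.
  by apply: weight1_line; rewrite -hh; apply: weight_lie.
have polar : lie y (lie f w) = c *: a.
  have : lie (y + w) (lie f (y + w)) = 0.
    by apply: selfP; rewrite -[y]scale1r; apply: gen_eigen_linear.
  rewrite linearDl !linearDr /= (selfP y) // (selfP w) // add0r addr0 => /eqP.
  by rewrite addr_eq0 -lieN zwE => /eqP.
have sc : s = c.
  have : lie z (lie y w) = - (s * h) *: y.
    by rewrite yw linearZ /= lieN ez scalerN scalerA scaleNr.
  rewrite lie_leibniz [lie z y]lieN selfP // oppr0 linear0l add0r zwE linearZ /= lieN ay.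
  rewrite scalerN scalerA -scaleNr => /eqP.
  rewrite -subr_eq0 -scalerBl scaler_eq0 (negPf y0) orbF.
  by rewrite opprK addrC -mulrBl mulf_eq0 (negPf h0) orbF subr_eq0 => /eqP.
have : lie f (lie y w) = (c + c) *: a by rewrite lie_leibniz zwE polar scalerDl.
rewrite yw linearZ /= lieN ef sc scalerN -scaleNr => /eqP.
rewrite -subr_eq0 -scalerBl scaler_eq0 (negPf a0) orbF -opprD oppr_eq0 addrA.
by rewrite -mulr2n -mulrSr -mulr_natl mulf_eq0 pnatr_eq0 (negPf c0).
Qed.

(** If [e, x] and [f, x] were both nonzero, z + 1 and z - 1 would be weights and
    z would vanish.  The remaining cases produce a vector of weight 1/2, namely x
    or [e, x]. *)
Lemma no_other_weight z x : G z x -> z != 0 -> z != 1 -> z != -1 -> x = 0.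
Proof.
move=> xG z0 z1 zm1; apply/eqP; case: eqP => // /eqP x0; exfalso.
have small w u : G w u -> u = 0 \/ `|w| <= 1.
  by move=> uG; have [->|/(bound uG)] := eqVneq u 0; [left|right].
have zle := bound xG x0.
have eex : lie e (lie e x) = 0.
  have [//|le] := small _ _ (Ge (Ge xG)).
  have := @norm_shift_eq0 _ (z + 1); rewrite addrK => /(_ le zle) /eqP.
  by rewrite addr_eq0 (negPf zm1).
have ffx : lie f (lie f x) = 0.
  have [//|le] := small _ _ (Gf (Gf xG)).
  have := @norm_shift_eq0 _ (z - 1); rewrite subrK => /(_ zle le) /eqP.
  by rewrite subr_eq0 (negPf z1).
have [ex|le1] := small _ _ (Ge xG).
  exact: (no_half_weight x0 (highest_weight_half xG z0 ex ffx)).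
have [fx|le2] := small _ _ (Gf xG); last by rewrite (norm_shift_eq0 le1 le2) eqxx in z0.
have ax := lowest_weight_half xG z0 fx eex.
apply: (@no_half_weight (lie e x)); last first.
  have eax : lie e (lie a x) *+ 2 = - lie e x by rewrite -raddfMn ax raddfN.
  by rewrite lie_leibniz ae mulrnDl eax mulr2n addrK.
apply: contraNneq x0 => ex; apply/eqP/(@gen_eigen_ker _ _ (ad a) z) => //.
by rewrite adE -ef -[LHS](addrK (lie f (lie e x))) -lie_leibniz fx ex !raddf0 addr0.
Qed.

Lemma rank_one_span x : x \in <<[:: a; e; f]>>%VS.
Proof.
have [s -> sP] := gen_eigen_decomp (ad a) x.
rewrite big_seq; apply: memv_suml => c /sP cG; move: (c.1) (c.2) cG => z y yG.
have sub u : u \in [:: a; e; f] -> (<[u]> <= <<[:: a; e; f]>>)%VS.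
  by move=> /memv_span; rewrite memvE.
have [z0|z0] := eqVneq z 0.
  by apply: (subvP (sub a _)); rewrite ?mem_head //; apply: Ca; rewrite -z0.
have [z1|z1] := eqVneq z 1.
  apply: (subvP (sub e _)); rewrite ?inE ?eqxx ?orbT //.
  by apply: weight1_line; rewrite -z1.
have [z2|z2] := eqVneq z (- 1).
  apply: (subvP (sub f _)); rewrite ?inE ?eqxx ?orbT //.
  by apply: weightN1_line; rewrite -z2.
by rewrite (no_other_weight yG) ?mem0v.
Qed.

Lemma rank_one_free : free [:: a; e; f].
Proof.
have nz (u v : L) : lie a u = u -> lie a v = - v -> u + v = 0 -> u = 0.
  move=> au av uv0; have := congr1 (lie a) uv0; rewrite raddfD /= au av raddf0.
  move=> /eqP; rewrite subr_eq0 => /eqP uv; move: uv0; rewrite -uv -mulr2n -scaler_nat.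
  by move=> /eqP; rewrite scaler_eq0 pnatr_eq0 => /eqP.
rewrite !free_cons nil_free andbT !span_cons span_nil !addv0 memv0.
have fN d : lie a (- (d *: f)) = - - (d *: f).
  by rewrite linearNr (linearZr_LR _ a) /= af scalerN.
apply/and3P; split=> //.
  apply: contra a0 => /memv_addP[_ /vlineP[c ->] [_ /vlineP[d ->] aE]].
  have cdf : c *: e = d *: f.
    apply/eqP; rewrite -subr_eq0; have := liexx a.
    by rewrite {2}aE linearD !linearZ /= ae af scalerN => ->.
  have c0 : c *: e = 0.
    by apply: (nz _ (- (d *: f)) _ (fN d)); [rewrite linearZ /= ae|rewrite cdf subrr].
  by rewrite aE -cdf c0 addr0.
apply: contra e0 => /vlineP[d eE]; apply/eqP.
by apply: (nz e (- (d *: f)) ae (fN d)); rewrite -eE subrr.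
Qed.

Lemma rank_one_dim3 : \dim {: L} = 3.
Proof.
rewrite (_ : fullv = <<[:: a; e; f]>>%VS).
  by apply/eqP/rank_one_free.
by apply/vspaceP => x; rewrite memvf rank_one_span.
Qed.
End RankOne.

Section ReductionToRankOne.
Variables (C : numClosedFieldType) (L : lieAlgType C).
Implicit Types a h x : L.

(** The weights z, z + 1, z + 2, ... are distinct and T has finitely many. *)
Lemma shift_eigen_vanish (V : vectType C) (T : 'End(V)) z (v : nat -> V) :
  (forall k, gen_eigen T (z + k%:R) (v k)) -> exists k, v k = 0.
Proof.
move=> Tv; have [r [rP _]] := spectrum T.
have [/existsP[k /eqP vk]|/existsPn v0] :=
  boolP [exists k : 'I_(size r).+1, v k == 0]; first by exists k.
pose s := [seq z + k%:R | k <- iota 0 (size r).+1].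
have us : uniq s.
  by rewrite map_inj_uniq ?iota_uniq // => i j /addrI/eqP; rewrite eqr_nat => /eqP.
have sr : {subset s <= r}.
  move=> _ /mapP[k + ->]; rewrite mem_iota add0n /= => kr.
  exact: rP (Tv k) (v0 (Ordinal kr)).
by have := uniq_leq_size us sr; rewrite size_map size_iota ltnn.
Qed.

Lemma iter_lie0 (x : L) k : iter k (lie x) 0 = 0.
Proof. by elim: k => //= k ->; rewrite raddf0. Qed.

Lemma iter_lie_sum (e x y : L) k :
  iter k (lie e) (x + y) = iter k (lie e) x + iter k (lie e) y.
Proof. by elim: k => //= k ->; rewrite raddfD. Qed.

Lemma lie_self_nilpotent (h e : L) : lie h e = e ->
  forall x, exists k, iter k (lie e) x = 0.
Proof.
move=> he x; have [s -> sP] := gen_eigen_decomp (ad h) x.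
rewrite big_seq; elim/big_ind: _ => [|u v [k ku] [l lv]|c /sP cG]; first by exists 0%N.
  exists (k + l)%N; rewrite iter_lie_sum {1}addnC !iterD ku lv.
  by rewrite !iter_lie0 addr0.
apply: (@shift_eigen_vanish _ (ad h) c.1) => k.
elim: k => [|k IH]; first by rewrite addr0.
rewrite mulrS addrCA /=; apply: gen_eigen_lie IH; first exact: ad_derivation.
by apply: eigen_gen_eigen; rewrite adE scale1r.
Qed.

(** If [a, [a, x]] = 0 then [a, x] = c a; were c nonzero, h = - x / c would
    satisfy [h, a] = a.  So ad a and its square have the same kernel. *)
Lemma nonsplit_null (a : L) : (forall x, lie a x = 0 -> x \in <[a]>%VS) ->
  (forall h, lie h a <> a) ->
  forall x, gen_eigen (ad a) 0 x -> x \in <[a]>%VS.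
Proof.
move=> Ca ha.
have aax x : lie a (lie a x) = 0 -> lie a x = 0.
  move=> /Ca/vlineP[c ax]; have [c0|c0] := eqVneq c 0; first by rewrite ax c0 scale0r.
  case: (ha (- c^-1 *: x)).
  by rewrite lieN linearZ /= scaleNr opprK ax scalerA mulVf ?scale1r.
move=> x [k kx]; apply: Ca; have {kx}: iter k.+1 (lie a) x = 0.
  rewrite iterS (_ : iter k (lie a) x = 0) ?raddf0 // -[RHS]kx.
  by apply: eq_iter => y; rewrite adE scale0r subr0.
by elim: k => // k IH kx; apply: IH; apply: aax.
Qed.

(** Let [h, x] = 0 and let (ad a)^k x be the last nonzero iterate.  It is a
    multiple of a, so its h-weight k equals 1.  Then [a, x] = t a = - t [a, h],
    so x + t h is a multiple s a of a, and applying ad h gives s a = 0. *)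
Lemma split_centralizer (a h : L) : a != 0 ->
    (forall x, lie a x = 0 -> x \in <[a]>%VS) -> lie h a = a ->
  forall x, lie h x = 0 -> x \in <[h]>%VS.
Proof.
move=> a0 Ca ha x hx.
have hk k : lie h (iter k (lie a) x) = k%:R *: iter k (lie a) x.
  elim: k => [|k IH]; first by rewrite hx scale0r.
  by rewrite /= lie_leibniz ha IH linearZ /= mulrSr scalerDl scale1r addrC.
have [k0 k0x] := lie_self_nilpotent ha x.
have exk : exists k, iter k (lie a) x == 0 by exists k0; apply/eqP.
case: (ex_minnP exk) => -[|k] /eqP kx kmin; first by rewrite [x]kx mem0v.
have /vlineP[t tE] := Ca (iter k (lie a) x) kx.
have kx0 : iter k (lie a) x != 0 by apply/negP => /kmin; rewrite ltnn.
have k1 : k = 1%N.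
  have := hk k; move: (iter k (lie a) x) tE kx0 => u uE u0.
  rewrite {1}uE linearZ /= ha -uE -{1}[u]scale1r => /eqP.
  rewrite -subr_eq0 -scalerBl scaler_eq0 (negPf u0) orbF.
  by rewrite subr_eq0 eq_sym -[1]/(1%:R) eqr_nat => /eqP.
move: tE; rewrite k1 /= => ax.
have /Ca/vlineP[s sE] : lie a (x + t *: h) = 0.
  by rewrite linearD linearZ /= ax [lie a h]lieN ha scalerN subrr.
have s0 : s = 0.
  have := congr1 (lie h) sE; rewrite linearD !linearZ /= hx liexx ha scaler0 addr0.
  by move=> /esym/eqP; rewrite scaler_eq0 (negPf a0) orbF => /eqP.
apply/vlineP; exists (- t); apply/eqP; rewrite -subr_eq0 scaleNr opprK.
by rewrite sE s0 scale0r.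
Qed.

Lemma max_norm (r : seq C) z0 : z0 \in r ->
  exists2 z, z \in r & forall w, w \in r -> `|w| <= `|z|.
Proof.
elim: r z0 => // y [|y' r] IH z0 _.
  by exists y; rewrite ?mem_head // => w; rewrite inE => /eqP->.
have [z zr zmax] := IH y' (mem_head _ _).
have : `|y| >=< `|z| by apply: real_comparable; apply: normr_real.
move=> /orP[yz|zy].
  exists z; first by rewrite in_cons zr orbT.
  by move=> w; rewrite inE => /orP[/eqP->|/zmax].
exists y; rewrite ?mem_head // => w; rewrite inE => /orP[/eqP->//|/zmax wz].
exact: le_trans zy.
Qed.

(** Divide a by a weight of maximal modulus. *)
Lemma rank_one_killing_dim3 (a : L) : killing_nondeg L -> a != 0 ->
  (forall x, gen_eigen (ad a) 0 x -> x \in <[a]>%VS) -> \dim {: L} = 3.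
Proof.
move=> nondeg a0 Ga.
have [r [rP rE]] := spectrum (ad a).
have [z1 z1r z10] : exists2 z, z \in r & z != 0.
  apply/hasP; apply: contraNT a0 => /hasPn r0; apply/eqP/nondeg => y.
  suff ad0 x : ad x = 0 by rewrite /killing ad0 comp_lfun0l raddf0.
  have inv x' : x' \in <[a]>%VS.
    have [s -> sP] := gen_eigen_decomp (ad a) x'.
    rewrite big_seq; apply: memv_suml => c /sP cG; have [->|c0] := eqVneq c.2 0.
      exact: mem0v.
    have := r0 _ (rP _ _ cG c0); rewrite negbK => /eqP c10.
    by apply: Ga; rewrite -c10.
  apply/lfunP => v; rewrite adE zero_lfunE.
  have /vlineP[c ->] := inv x; have /vlineP[d ->] := inv v.
  by rewrite linearZl_LR linearZr_LR /= liexx !scaler0.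
have [z zr zmax] := max_norm z1r.
have z0 : z != 0.
  by rewrite -normr_gt0 (lt_le_trans _ (zmax _ z1r)) // normr_gt0.
have [e e0 ae] := rE _ zr.
pose b := z^-1 *: a.
have bG w x : gen_eigen (ad b) w x -> gen_eigen (ad a) (z * w) x.
  move=> [k kx]; exists k; apply/eqP.
  have := kx.
  rewrite (_ : iter k _ x =
    z^-1 ^+ k *: iter k (fun y => ad a y - (z * w) *: y) x).
    by move=> /eqP; rewrite scaler_eq0 expf_eq0 invr_eq0 (negPf z0) andbF.
  elim: k {kx} => [|k /= ->]; first by rewrite scale1r.
  rewrite linearZ /= !adE linearZl_LR /= exprS scalerBr !scalerA; congr (_ *: _ - _ *: _).
    by rewrite mulrC.
  by move: (_ ^+ k) => p; field.
have be : lie b e = e by rewrite linearZl_LR /= -adE ae scalerA mulVf ?scale1r.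
have b0 : b != 0 by rewrite scaler_eq0 invr_eq0 (negPf z0).
have Gb x : gen_eigen (ad b) 0 x -> x \in <[b]>%VS.
  move=> /bG; rewrite mulr0 => /Ga/vlineP[c ->]; apply/vlineP; exists (c * z).
  by rewrite scalerA mulfK.
have bbound w x : gen_eigen (ad b) w x -> x != 0 -> `|w| <= 1.
  move=> /bG xG /(rP _ _ xG)/zmax; rewrite normrM -[X in _ <= X]mulr1.
  by rewrite ler_pM2l ?normr_gt0.
have [f bf ef] := sl2_triple_exists nondeg b0 Gb bbound e0 be.
exact: (rank_one_dim3 nondeg b0 Gb bbound e0 be bf ef).
Qed.

(** If [h, a] = a then h can replace a: a further h' with [h', h] = h would make
    ad h locally nilpotent, contradicting [h, a] = a. *)
Theorem centralizer_line_dim3 (a : L) : killing_nondeg L -> a != 0 ->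
  (forall x, lie a x = 0 -> x \in <[a]>%VS) -> \dim {: L} = 3.
Proof.
move=> nondeg a0 Ca.
have [[h ha]|noh] := pselect (exists h, lie h a = a); last first.
  apply: (rank_one_killing_dim3 nondeg a0); apply: nonsplit_null => // h ha.
  by apply: noh; exists h.
have Ch := split_centralizer a0 Ca ha.
have h0 : h != 0 by apply: contraNneq a0 => h0; rewrite -ha h0 linear0l.
apply: (rank_one_killing_dim3 nondeg h0); apply: nonsplit_null => // h' h'h.
have [k] := lie_self_nilpotent h'h a.
suff -> : iter k (lie h) a = a by move=> a00; rewrite a00 eqxx in a0.
by elim: k => //= k ->.
Qed.
End ReductionToRankOne.

(** * Classification in dimension three *)

Section Triples.
Variable F : fieldType.

Definition cyclic_triple (L : lieAlgType F) (c1 c2 c3 : F) : Prop :=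
  exists x y z : L, [/\ basis_of fullv [:: x; y; z],
    lie y z = c1 *: x, lie z x = c2 *: y & lie x y = c3 *: z].

Lemma cyclic_triple_rot L c1 c2 c3 :
  cyclic_triple L c1 c2 c3 -> cyclic_triple L c2 c3 c1.
Proof.
move=> [x [y [z [b yz zx xy]]]]; exists y, z, x; split=> //.
rewrite (perm_basis (Y := [:: x; y; z])) //.
by rewrite -[[:: y; z; x]]/(rot 1 [:: x; y; z]) perm_rot.
Qed.

Lemma cyclic_triple_scale L c1 c2 c3 d1 d2 d3 (k1 k2 k3 : F) :
    k1 != 0 -> k2 != 0 -> k3 != 0 ->
    k2 * k3 * c1 = d1 * k1 -> k3 * k1 * c2 = d2 * k2 -> k1 * k2 * c3 = d3 * k3 ->
  cyclic_triple L c1 c2 c3 -> cyclic_triple L d1 d2 d3.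
Proof.
move=> k1n k2n k3n e1 e2 e3 [x [y [z [b yz zx xy]]]].
exists (k1 *: x), (k2 *: y), (k3 *: z); split; last 3 first.
- by rewrite linearZl_LR linearZr_LR /= yz !scalerA e1.
- by rewrite linearZl_LR linearZr_LR /= zx !scalerA e2.
- by rewrite linearZl_LR linearZr_LR /= xy !scalerA e3.
move: b; rewrite !basisEdim => /andP[sp ->]; rewrite andbT.
apply: subv_trans sp _; apply/span_subvP => u.
have unscale k (v : L) (s : seq L) : k != 0 -> k *: v \in s -> v \in <<s>>%VS.
  by move=> k0 /memv_span kv; rewrite -[v]scale1r -(mulVf k0) -scalerA memvZ.
rewrite !inE => /or3P[]/eqP->;
  [apply: (unscale k1)|apply: (unscale k2)|apply: (unscale k3)] => //;
  by rewrite !inE eqxx ?orbT.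
Qed.

(** Negating all three vectors leaves the brackets fixed. *)
Lemma cyclic_triple_opp L c1 c2 c3 :
  cyclic_triple L c1 c2 c3 -> cyclic_triple L (- c1) (- c2) (- c3).
Proof.
have n1 : -1 != 0 :> F by rewrite oppr_eq0 oner_eq0.
by apply: (cyclic_triple_scale n1 n1 n1); ring.
Qed.

(** The linear map that sends one basis to the other is a morphism.  Being linear
    in each argument, this is checked on basis vectors, one argument after the
    other. *)
Lemma cyclic_triple_iso (L M : lieAlgType F) c1 c2 c3 :
  cyclic_triple L c1 c2 c3 -> cyclic_triple M c1 c2 c3 -> lie_isomorphic L M.
Proof.
move=> [x [y [z [b yz zx xy]]]] [x' [y' [z' [b' yz' zx' xy']]]].
have fr := basis_free b; have fr' := basis_free b'.
have sp := span_basis b; have sp' := span_basis b'.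
have [f0 /(_ fr erefl)[f0x f0y f0z]] := linear_of_free [:: x; y; z] [:: x'; y'; z'].
have [g0 /(_ fr' erefl)[g0x g0y g0z]] := linear_of_free [:: x'; y'; z'] [:: x; y; z].
pose f := linfun f0; pose g := linfun g0.
have [fx fy fz] : [/\ f x = x', f y = y' & f z = z'] by rewrite !lfunE.
have [gx gy gz] : [/\ g x' = x, g y' = y & g z' = z] by rewrite !lfunE.
have ext (V : vectType F) (p q : 'Hom(L, V)) :
    p x = q x -> p y = q y -> p z = q z -> p = q.
  move=> px py pz; apply/(fullv_lfunP _ _ sp) => u.
  by rewrite !inE => /or3P[]/eqP->.
have ext' (V : vectType F) (p q : 'Hom(M, V)) :
    p x' = q x' -> p y' = q y' -> p z' = q z' -> p = q.
  move=> px py pz; apply/(fullv_lfunP _ _ sp') => u.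
  by rewrite !inE => /or3P[]/eqP->.
have adf u : u \in [:: x; y; z] -> (f \o ad u)%VF = (ad (f u) \o f)%VF.
  have zy : lie z y = - (c1 *: x) by rewrite lieN yz.
  have zy' : lie z' y' = - (c1 *: x') by rewrite lieN yz'.
  have xz : lie x z = - (c2 *: y) by rewrite lieN zx.
  have xz' : lie x' z' = - (c2 *: y') by rewrite lieN zx'.
  have yx : lie y x = - (c3 *: z) by rewrite lieN xy.
  have yx' : lie y' x' = - (c3 *: z') by rewrite lieN xy'.
  rewrite !inE => /or3P[]/eqP->; apply: ext;
    rewrite !comp_lfunE !adE ?fx ?fy ?fz ?liexx ?linear0 //
      ?(yz, zx, xy, zy, xz, yx) ?(yz', zx', xy', zy', xz', yx') ?linearN linearZ /=;
    by rewrite ?fx ?fy ?fz.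
exists f; split.
  exists g => u; rewrite -comp_lfunE -[RHS]id_lfunE; congr (fun_of_lfun _ u).
    by apply: ext; rewrite comp_lfunE id_lfunE ?(fx, fy, fz) ?(gx, gy, gz).
  by apply: ext'; rewrite comp_lfunE id_lfunE ?(gx, gy, gz) ?(fx, fy, fz).
move=> u v; have /lfunP/(_ u) : (f \o ad v)%VF = (ad (f v) \o f)%VF.
  have H w t : w \in [:: x; y; z] -> f (lie w t) = lie (f w) (f t).
    by move=> /adf/lfunP/(_ t); rewrite !comp_lfunE !adE.
  by apply: ext; rewrite !comp_lfunE !adE [lie v _]lieN linearN /= H
    ?inE ?eqxx ?orbT // -lieN.
by rewrite !comp_lfunE !adE => H; rewrite [lie u v]lieN linearN /= H -lieN.
Qed.
End Triples.

Lemma basis3 (F : fieldType) (V : vectType F) (x y z : V) :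
    (forall a b c, a *: x + b *: y + c *: z = 0 -> [/\ a = 0, b = 0 & c = 0]) ->
    (forall u, exists a b c, u = a *: x + b *: y + c *: z) ->
  basis_of fullv [:: x; y; z].
Proof.
move=> fr sp; apply/andP; split.
  apply/eqP/vspaceP => u; rewrite memvf; have [a [b [c ->]]] := sp u.
  by rewrite !memvD ?memvZ ?memv_span // !inE eqxx ?orbT.
rewrite -[[:: x; y; z]]/(val [tuple x; y; z]); apply/freeP => k.
rewrite !big_ord_recl big_ord0 addr0 addrA /= => /fr[k0 k1 k2] i.
case: i => [[|[|[|//]]] ilt].
- by rewrite -k0; congr k; apply: val_inj.
- by rewrite -k1; congr k; apply: val_inj.
- by rewrite -k2; congr k; apply: val_inj.
Qed.

Section Models.
Variable R : realFieldType.

Definition mx_of_rows n (s : seq (seq R)) : 'M[R]_n :=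
  \matrix_(i, k) nth 0 (nth [::] s i) k.

(** The matrix of the cross product with (a, b, c). *)
Definition cross_mx (a b c : R) : 'M[R]_3 :=
  mx_of_rows 3 [:: [:: 0; - c; b]; [:: c; 0; - a]; [:: - b; a; 0]].

Local Notation o0 := (@Ordinal 3 0 isT).
Local Notation o1 := (@Ordinal 3 1 isT).
Local Notation o2 := (@Ordinal 3 2 isT).

Lemma matrix3P (A B : 'M[R]_3) :
  (forall i k, i \in [:: o0; o1; o2] -> k \in [:: o0; o1; o2] -> A i k = B i k) ->
  A = B.
Proof.
move=> AB; apply/matrixP => i k; apply: AB.
  by case: i => [[|[|[|//]]] i].
by case: k => [[|[|[|//]]] k].
Qed.

Lemma cross_mx_so a b c : cross_mx a b c \in so_vs R 3.
Proof.
rewrite mem_so; apply/eqP/matrixP.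
by move=> [[|[|[|//]]] i] [[|[|[|//]]] k]; rewrite !mxE /= ?opprK ?oppr0.
Qed.

Lemma cross_mx_lie a b c a' b' c' :
  lie (cross_mx a b c) (cross_mx a' b' c') =
  cross_mx (b * c' - c * b') (c * a' - a * c') (a * b' - b * a').
Proof.
apply/matrixP; rewrite /lie /= /commutator.
by move=> [[|[|[|//]]] i] [[|[|[|//]]] k];
  rewrite !mxE !big_ord_recl !big_ord0 !mxE /=; ring.
Qed.

Definition cross_so a b c : so R 3 := vsproj _ (cross_mx a b c).

Lemma cross_so_lie a b c a' b' c' :
  lie (cross_so a b c) (cross_so a' b' c') =
  cross_so (b * c' - c * b') (c * a' - a * c') (a * b' - b * a').
Proof.
by apply: subvs_inj; rewrite val_liesub !vsprojK ?cross_mx_so // cross_mx_lie.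
Qed.

Lemma so3_cyclic_triple : cyclic_triple (so R 3) 1 1 1.
Proof.
pose e1 := cross_so 1 0 0; pose e2 := cross_so 0 1 0; pose e3 := cross_so 0 0 1.
have valE a b c : vsval (a *: e1 + b *: e2 + c *: e3) = cross_mx a b c.
  rewrite !linearD !linearZ /= !vsprojK ?cross_mx_so //; apply/matrixP.
  by move=> [[|[|[|//]]] i] [[|[|[|//]]] k]; rewrite !mxE /=; ring.
exists e1, e2, e3; split; last 3 first.
- by rewrite cross_so_lie scale1r; congr cross_so; ring.
- by rewrite cross_so_lie scale1r; congr cross_so; ring.
- by rewrite cross_so_lie scale1r; congr cross_so; ring.
apply: basis3 => [a b c abc|u].
  have := valE a b c; rewrite abc => /matrixP A0.
  by have := (A0 o2 o1, A0 o0 o2, A0 o1 o0); rewrite !mxE /= => -[[-> ->] ->].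
have := subvsP u; rewrite mem_so => /eqP/matrixP uT.
set A := vsval u in uT.
have AT i k : A i k = - A k i by have := uT k i; rewrite !mxE.
have A0 i : A i i = 0.
  by apply/eqP; rewrite -[_ == _](mulrn_eq0 _ 2) mulr2n {1}AT addNr.
exists (A o2 o1), (A o0 o2), (A o1 o0).
apply: subvs_inj; rewrite valE -/A; apply: matrix3P => i k.
by rewrite !inE => /or3P[]/eqP-> /or3P[]/eqP->; rewrite !mxE /= ?A0 //; exact: AT.
Qed.

(** Coordinates in the basis H / 2, (E + F) / 2, (E - F) / 2 of sl(2), where
    H, E, F is the standard triple. *)
Definition split_mx (a b c : R) : 'M[R]_2 :=
  mx_of_rows 2 [:: [:: a / 2; (b + c) / 2]; [:: (b - c) / 2; - a / 2]].

Lemma split_mx_sl a b c : split_mx a b c \in sl_vs R 2.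
Proof.
by rewrite mem_sl /mxtrace !big_ord_recl big_ord0 !mxE /= addr0 mulNr subrr.
Qed.

Lemma split_mx_lie a b c a' b' c' :
  lie (split_mx a b c) (split_mx a' b' c') =
  split_mx (c * b' - b * c') (a * c' - c * a') (a * b' - b * a').
Proof.
apply/matrixP; rewrite /lie /= /commutator.
by move=> [[|[|//]] i] [[|[|//]] k];
  rewrite !mxE !big_ord_recl !big_ord0 !mxE /=; field.
Qed.

Definition split_sl a b c : sl R 2 := vsproj _ (split_mx a b c).

Lemma split_sl_lie a b c a' b' c' :
  lie (split_sl a b c) (split_sl a' b' c') =
  split_sl (c * b' - b * c') (a * c' - c * a') (a * b' - b * a').
Proof.
by apply: subvs_inj; rewrite val_liesub !vsprojK ?split_mx_sl // split_mx_lie.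
Qed.

Lemma split_slZ k a b c : k *: split_sl a b c = split_sl (k * a) (k * b) (k * c).
Proof.
apply: subvs_inj; rewrite linearZ /= !vsprojK ?split_mx_sl //; apply/matrixP.
by move=> [[|[|//]] i] [[|[|//]] l]; rewrite !mxE /=; field.
Qed.

Lemma sl2_cyclic_triple : cyclic_triple (sl R 2) (-1) (-1) 1.
Proof.
pose e1 := split_sl 1 0 0; pose e2 := split_sl 0 1 0; pose e3 := split_sl 0 0 1.
have valE a b c : vsval (a *: e1 + b *: e2 + c *: e3) = split_mx a b c.
  rewrite !linearD !linearZ /= !vsprojK ?split_mx_sl //; apply/matrixP.
  by move=> [[|[|//]] i] [[|[|//]] k]; rewrite !mxE /=; field.
pose p0 := @Ordinal 2 0 isT; pose p1 := @Ordinal 2 1 isT.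
exists e1, e2, e3; split; last 3 first.
- by rewrite split_sl_lie split_slZ; congr split_sl; ring.
- by rewrite split_sl_lie split_slZ; congr split_sl; ring.
- by rewrite split_sl_lie split_slZ; congr split_sl; ring.
apply: basis3 => [a b c abc|u].
  have := valE a b c; rewrite abc => /matrixP A0.
  have := (A0 p0 p0, A0 p0 p1, A0 p1 p0); rewrite !mxE /= => -[[a0 bc] bc'].
  by split; lra.
have := subvsP u; rewrite mem_sl /mxtrace !big_ord_recl big_ord0 addr0 => /eqP.
set A := vsval u; rewrite (_ : lift ord0 ord0 = p1); last exact: val_inj.
rewrite (_ : ord0 = p0); last exact: val_inj.
move=> tr0; have trE : A p1 p1 = - A p0 p0.
  by apply/eqP; rewrite -addr_eq0 addrC tr0.
exists (2 * A p0 p0), (A p0 p1 + A p1 p0), (A p0 p1 - A p1 p0).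
apply: subvs_inj; rewrite valE -/A; apply/matrixP => i k.
have ordE (l : 'I_2) : l = p0 \/ l = p1.
  by case: l => [[|[|//]] lt]; [left|right]; apply: val_inj.
by have [->|->] := ordE i; have [->|->] := ordE k; rewrite !mxE /= ?trE; field.
Qed.
End Models.

Section DimensionThree.
Variables (R : realFieldType) (L : lieAlgType R).
Hypothesis nondeg : killing_nondeg L.
Implicit Types (x y z u v : L) (s : seq L).

Definition killing_orthogonal s :=
  all (fun x => killing x x != 0) s && pairwise (fun x y => killing x y == 0) s.

Lemma killing_projection s u : killing_orthogonal s ->
  exists2 p, p \in <<s>>%VS & forall x, x \in s -> killing x (u - p) = 0.
Proof.
elim: s => [|x s IH] /andP[] /=; first by exists 0; rewrite ?mem0v.
move=> /andP[xx sn] /andP[/allP xs ss].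
have [|p ps pP] := IH; first by apply/andP.
pose c := killing x (u - p) / killing x x.
exists (c *: x + p).
  by rewrite span_cons memv_add ?memvZ ?memv_line.
have -> : u - (c *: x + p) = (u - p) - c *: x by rewrite opprD addrCA addrC.
move=> y; rewrite inE linearBr linearZr_LR /= => /orP[/eqP->|ys].
  by rewrite divfK // subrr.
by rewrite pP // killingC (eqP (xs _ ys)) mulr0 subrr.
Qed.

Lemma killing_span0 s y p :
  (forall x, x \in s -> killing y x = 0) -> p \in <<s>>%VS -> killing y p = 0.
Proof.
move=> ys ps; rewrite (coord_span (X := in_tuple s) ps) linear_sumr big1 // => i _.
by rewrite linearZr_LR /= ys ?mulr0 // mem_nth.
Qed.

Lemma killing_orthogonal_free s : killing_orthogonal s -> free s.
Proof.
elim: s => [|x s IH] /andP[] /=; first by rewrite nil_free.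
move=> /andP[xx sn] /andP[/allP xs ss]; rewrite free_cons IH ?andbT; last exact/andP.
apply: contra xx => /killing_span0 xxs; apply/eqP/xxs => y /xs.
by move=> /eqP.
Qed.

(** Orthogonal projection off the span of s produces v != 0 orthogonal to s, and
    nondegeneracy produces w orthogonal to s with B(v, w) != 0.  If v and w are
    both isotropic then v + w is not. *)
Lemma killing_orthogonal_extend s : killing_orthogonal s -> (size s < \dim {: L})%N ->
  exists y, killing_orthogonal (y :: s).
Proof.
move=> so sL.
have /subvPn[u _ us] : ~~ (fullv <= <<s>>)%VS.
  by apply: contraL sL => /dimvS Ls; rewrite -leqNgt (leq_trans Ls) ?dim_span.
have [p ps pP] := killing_projection u so.
set v := u - p in pP.
have v0 : v != 0 by apply: contraNneq us => /eqP; rewrite subr_eq0 => /eqP->.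
have [w0 vw0] := killing_nondeg_exists nondeg v0.
have [q qs qP] := killing_projection w0 so; set w := w0 - q in qP.
have vw : killing v w != 0.
  rewrite linearBr /= (@killing_span0 s v q) ?subr0 // => x xs.
  by rewrite killingC pP.
clearbody v w.
have good y : (forall x, x \in s -> killing x y = 0) -> killing y y != 0 ->
    exists y, killing_orthogonal (y :: s).
  move=> ys yy; exists y; case/andP: so => so1 so2.
  rewrite /killing_orthogonal /= yy so1 so2 /= andbT; apply/allP => x xs.
  by rewrite killingC ys.
have [vv|] := eqVneq (killing v v) 0; last exact: good.
have [ww|] := eqVneq (killing w w) 0; last exact: good.
apply: (good (v + w)) => [x xs|]; first by rewrite linearDr /= pP // qP // addr0.
rewrite linearDl !linearDr /= vv ww add0r addr0 [killing w v]killingC.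
by rewrite -mulr2n mulrn_eq0.
Qed.

Lemma killing_lie_self x y : killing (lie x y) x = 0 /\ killing (lie x y) y = 0.
Proof.
by rewrite [killing _ y]killing_lie lieN linearNl /= killing_lie !liexx !linear0r oppr0.
Qed.

(** A vector orthogonal to two axes of an orthogonal basis lies on the third. *)
Lemma killing_axis x y z v : <<[:: x; y; z]>>%VS = fullv -> killing z z != 0 ->
    killing z x = 0 -> killing z y = 0 -> killing v x = 0 -> killing v y = 0 ->
  v = (killing v z / killing z z) *: z.
Proof.
move=> sp zz zx zy vx vy; apply/eqP; rewrite -subr_eq0; apply/eqP/nondeg => u.
apply: (@killing_span0 [:: x; y; z]); last by rewrite sp memvf.
move=> t; rewrite !inE linearBl linearZl_LR /= => /or3P[]/eqP->.
- by rewrite vx zx mulr0 subrr.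
- by rewrite vy zy mulr0 subrr.
- by rewrite divfK // subrr.
Qed.

(** In a Killing-orthogonal basis x, y, z the number t = B([x, y], z) is invariant
    under cyclic permutation, and the brackets are [x, y] = (t / B(z, z)) z and its
    rotations.  If t were 0 then ad x = 0, hence B(x, x) = 0. *)
Lemma killing_cyclic_triple : \dim {: L} = 3 -> exists c1 c2 c3 : R,
  [/\ c1 != 0, c2 != 0 & c3 != 0] /\ cyclic_triple L c1 c2 c3.
Proof.
move=> dim3.
have [|z zo] := @killing_orthogonal_extend [::] isT; first by rewrite dim3.
have [|y yo] := killing_orthogonal_extend zo; first by rewrite dim3.
have [|x xo] := killing_orthogonal_extend yo; first by rewrite dim3.
have b : basis_of fullv [:: x; y; z].
  by rewrite basisEfree killing_orthogonal_free // subvf dim3.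
have sp := span_basis b.
move: xo; rewrite /killing_orthogonal /= !andbT => /andP[/and3P[xx yy zz]].
move=> /andP[/andP[/eqP xy /eqP xz] /eqP yz].
have yx : killing y x = 0 by rewrite killingC.
have zx : killing z x = 0 by rewrite killingC.
have zy : killing z y = 0 by rewrite killingC.
have sp1 : <<[:: y; z; x]>>%VS = fullv.
  by rewrite -sp; apply: eq_span => u; rewrite !inE orbA orbC.
have sp2 : <<[:: z; x; y]>>%VS = fullv.
  by rewrite -sp; apply: eq_span => u; rewrite !inE orbC orbA.
pose t := killing (lie x y) z.
have lxy : lie x y = (t / killing z z) *: z.
  by have [] := killing_lie_self x y; apply: killing_axis.
have lyz : lie y z = (t / killing x x) *: x.
  have -> : t = killing (lie y z) x by rewrite killingC -killing_lie.
  by have [] := killing_lie_self y z; apply: killing_axis.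
have lzx : lie z x = (t / killing y y) *: y.
  have -> : t = killing (lie z x) y by rewrite killing_lie killingC.
  by have [] := killing_lie_self z x; apply: killing_axis.
have t0 : t != 0.
  apply: contraNneq xx => t0; rewrite /killing (_ : ad x = 0) ?comp_lfun0l ?raddf0 //.
  apply/(fullv_lfunP _ _ sp) => u; rewrite zero_lfunE adE !inE => /or3P[]/eqP->.
  - exact: liexx.
  - by rewrite lxy t0 mul0r scale0r.
  - by rewrite lieN lzx t0 mul0r scale0r oppr0.
exists (t / killing x x), (t / killing y y), (t / killing z z); split.
  by rewrite !mulf_neq0 ?invr_eq0.
by exists x, y, z.
Qed.
End DimensionThree.

(** Write c_i = sg(c_i) s_i^2.  Multiplying the vectors by 1 / (s_2 s_3) and its
    rotations turns each coefficient c_i into its sign. *)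
Lemma cyclic_triple_sg (R : rcfType) (L : lieAlgType R) (c1 c2 c3 : R) :
    c1 != 0 -> c2 != 0 -> c3 != 0 -> cyclic_triple L c1 c2 c3 ->
  cyclic_triple L (Num.sg c1) (Num.sg c2) (Num.sg c3).
Proof.
move=> n1 n2 n3.
have root (c : R) : c != 0 -> exists2 s, s != 0 & c = Num.sg c * (s * s).
  move=> c0; exists (Num.sqrt `|c|); first by rewrite sqrtr_eq0 -ltNge normr_gt0.
  by rewrite -expr2 sqr_sqrtr // -numEsg.
have [s1 s10 e1] := root _ n1; have [s2 s20 e2] := root _ n2.
have [s3 s30 e3] := root _ n3.
apply: (@cyclic_triple_scale _ _ _ _ _ _ _ _ (s2 * s3)^-1 (s3 * s1)^-1 (s1 * s2)^-1);
  rewrite ?invr_eq0 ?mulf_neq0 //.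
- by rewrite {1}e1; field; rewrite s10 s20 s30.
- by rewrite {1}e2; field; rewrite s10 s20 s30.
- by rewrite {1}e3; field; rewrite s10 s20 s30.
Qed.

(** Equal signs give so(3).  Otherwise one sign differs from the other two; a
    rotation moves it to the third place, and a global sign change makes it
    positive, which is the pattern of sl(2). *)
Theorem dim3_classification (R : rcfType) (L : lieAlgType R) :
  killing_nondeg L -> \dim {: L} = 3 ->
  lie_isomorphic L (so R 3) \/ lie_isomorphic L (sl R 2).
Proof.
move=> nondeg dim3.
have [c1 [c2 [c3 [[n1 n2 n3]]]]] := killing_cyclic_triple nondeg dim3.
move=> /(cyclic_triple_sg n1 n2 n3).
have toso : cyclic_triple L 1 1 1 -> lie_isomorphic L (so R 3).
  by move=> t; apply: cyclic_triple_iso t (so3_cyclic_triple R).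
have tosl : cyclic_triple L (-1) (-1) 1 -> lie_isomorphic L (sl R 2).
  by move=> t; apply: cyclic_triple_iso t (sl2_cyclic_triple R).
have sgE (c : R) : c != 0 -> Num.sg c = 1 \/ Num.sg c = -1.
  by move=> c0; rewrite sgr_def c0; case: (c < 0); [right|left].
have [->|->] := sgE _ n1; have [->|->] := sgE _ n2; have [->|->] := sgE _ n3.
- by left; apply: toso.
- by move=> /cyclic_triple_opp; rewrite opprK; right; apply: tosl.
- move=> /cyclic_triple_rot/cyclic_triple_rot/cyclic_triple_opp; rewrite opprK.
  by right; apply: tosl.
- by move=> /cyclic_triple_rot; right; apply: tosl.
- by move=> /cyclic_triple_rot/cyclic_triple_opp; rewrite opprK; right; apply: tosl.
- by move=> /cyclic_triple_rot/cyclic_triple_rot; right; apply: tosl.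
- by right; apply: tosl.
- by move=> /cyclic_triple_opp; rewrite opprK; left; apply: toso.
Qed.

(** * CR kahlerian structures of codimension one *)

(** The form <x, j y> equals B([a, x], y).  Its left kernel is the kernel of
    ad a because B is nondegenerate, and the kernel of j because the scalar
    product is definite. *)
Lemma CR_kahlerian_fundamental_element (R : realType) (G : lieAlgType R)
    (H : {vspace G}) (j : 'End(G)) (dot : {dot G for idfun}) :
    CR_kahlerian H j dot -> killing_nondeg G ->
  exists a : G, forall x, (lie a x == 0) = (j x == 0).
Proof.
move=> CR nondeg.
have [||x y|x y z|a aP] := @closed_form_inner _ _ (fun x y => dot x (j y)) _ _ nondeg.
- by move=> x c u v; rewrite !linearP.
- by move=> y c u v; rewrite linearPl.
- exact: CR_antisym CR y x.
- exact: CR_closed CR x y z.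
exists a => x; apply/eqP/eqP => [ax|jx].
  apply/eqP; apply: contraT => /(neq0_dnorm_gt0 (s := dot)).
  by rewrite (CR_antisym CR) aP ax linear0l oppr0 ltxx.
apply: nondeg => y; rewrite -aP (CR_antisym CR) jx.
by rewrite linear0r oppr0.
Qed.

Theorem corollary3p2 (R : realType) (G : lieAlgType R) (H : {vspace G})
    (j : 'End(G)) (dot : {dot G for idfun}) :
  CR_kahlerian H j dot -> semisimple G -> (\dim H + 1 = \dim {:G})%N ->
  lie_isomorphic G (so R 3) \/ lie_isomorphic G (sl R 2).
Proof.
move=> CR /semisimple_killing_nondeg nondeg dimH.
apply: dim3_classification => //; rewrite -dim_cplx.
have [a aj] := CR_kahlerian_fundamental_element CR nondeg.
have dimK : \dim (lker j) = 1%N.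
  apply/eqP; rewrite -(eqn_add2r (\dim H)) [(1 + _)%N]addnC dimH -(CR_image CR).
  by rewrite -[X in _ == X](limg_ker_dim j fullv) capfv.
have lineK u : u \in lker j -> u != 0 -> (lker j = <[u]>)%VS.
  move=> uK u0; apply/esym/eqP; rewrite eqEdim -memvE uK dimK dim_vline.
  by rewrite u0.
(* If a were 0 then j would vanish, G would be a line, hence abelian, and its
   Killing form would be 0. *)
have a0 : a != 0.
  apply/eqP => a0.
  have jK : lker j = fullv.
    by apply/vspaceP => x; rewrite memvf memv_ker -aj a0 linear0l eqxx.
  have [u uK u0] : exists2 u, u \in lker j & u != 0.
    exists (vpick (lker j)); rewrite ?memv_pick // vpick0 -dimv_eq0 dimK //.
  have ad0 : ad u = 0.
    apply/lfunP => x; have := memvf x; rewrite -jK (lineK _ uK u0) => /vlineP[c ->].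
    by rewrite adE linearZ /= liexx scaler0 zero_lfunE.
  move/eqP: u0; apply; apply: nondeg => y.
  by rewrite /killing ad0 comp_lfun0l raddf0.
have aK : a \in lker j by rewrite memv_ker -aj liexx.
apply: (@centralizer_line_dim3 R[i] _ (cplx_emb a)).
- exact: killing_nondeg_cplx.
- by rewrite -(raddf0 (@cplx_emb R G)) (inj_eq (@cplx_emb_inj _ _)).
- apply: centralizer_cplx => x ax; rewrite -(lineK _ aK a0) memv_ker -aj.
  exact/eqP.
Qed.
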